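(* Let $(M,\Delta_M)$ be a compact Woronowicz algebra with invariant state $\varphi_M$, and let $(N,\Delta_N)$ be a right Galois co-object for $(M,\Delta_M)$, with associated unitary $\widetilde W: L^2(N)\otimes L^2(N)\to L^2(M)\otimes L^2(N)$ and dual von Neumann algebra $\widehat N=\bigoplus_{r\in I_N}B(\mathcal H_r)$, $n_r=\dim\mathcal H_r\in\{1,2,\ldots\}\cup\{\infty\}$. With matrix units $e_{r,ij}$ and eigenvalues $T_{r,j}$ as in the context, put $\widetilde W_{r,ij}=(\iota\otimes\omega_{r,ji})(\widetilde W)\in N^{\mathrm{op}}\subseteq B(L^2(N),L^2(M))$. Then: 1. $\widetilde W$ equals the strongly$^*$ convergent sum $\sum_{r\in I_N}\sum_{i,j=0}^{n_r-1}\widetilde W_{r,ij}\otimes e_{r,ij}$. 2. For each $r\in I_N$ and $0\le i,j<n_r$, $\sum_{k=0}^{n_r-1}\widetilde W_{r,ik}\widetilde W_{r,jk}^*=\delta_{i,j}1_{L^2(M)}$ and $\sum_{k=0}^{n_r-1}\widetilde W_{r,ki}^*\widetilde W_{r,kj}=\delta_{i,j}1_{L^2(N)}$, both sums converging strongly. 3. For each $r\in I_N$ and $0\le i,j<n_r$, $\Delta_N(\widetilde W_{r,ij}^* )=\sum_{k=0}^{n_r-1}\widetilde W_{r,ik}^*\otimes\widetilde W_{r,kj}^*$, the sum converging strongly$^*$. 4. For all $r,s\in I_N$, $0\le i,j<n_r$, $0\le k,l<n_s$: $\varphi_M(\widetilde W_{r,ij}\widetilde W_{s,kl}^* )=\d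elta_{r,s}\delta_{i,k}\delta_{j,l}\,T_{r,j}$.
   Context: Conventions: Hilbert spaces are separable, inner products are linear in the first variable, von Neumann algebras have separable predual; $\bar\otimes$ is the $\sigma$-weakly closed spatial tensor product (of von Neumann algebras or of $\sigma$-weakly closed operator spaces); $\Sigma$ is the flip on a tensor product of Hilbert spaces; leg numbering notation is used. A von Neumann bialgebra $(M,\Delta_M)$ is a von Neumann algebra $M$ with a faithful normal unital $^*$-homomorphism $\Delta_M:M\to M\bar\otimes M$ satisfying $(\Delta_M\otimes\iota)\Delta_M=(\iota\otimes\Delta_M)\Delta_M$. It is a compact Woronowicz algebra if there is a normal state $\varphi_M$ on $M$ with $(\varphi_M\otimes\iota)\Delta_M(x)=(\iota\otimes\varphi_M)\Delta_M(x)=\varphi_M(x)1$ for all $x\in M$; this state is unique and faithful. $M$ acts on the GNS space $L^2(M)$ of $\varphi_M$, with cyclic separating vector $\xi_M$. A right Galois co-object for $(M,\Delta_M)$ consists of a Hilbert space $L^2(N)$, a $\sigma$-weakly closed linear space $N\subseteq B(L^2(M),L^2(N))$ and a normal linear map $\Delta_N:N\to N\bar\otimes N$ such that, with $N^{\mathrm{op}}=\{x^*\mid x\in N\}$: (1) $N\cdot L^2(M)$ is norm-dense in $L^2(N)$ and $N^{\mathrm{op}}\cdot L^2(N)$ is norm-dense in $L^2(M)$; (2) $NM\subseteq N$; (3) $x^*y\in M$ for $x,y\in N$; (4) $\Delta_N(xy)=\Delta_N(x)\Delta_M(y)$ for $x\in N,y\in M$; (5) $\Delta_N(x)^*\Delta_N(y)=\Delta_M(x^*y)$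 for $x,y\in N$; (6) $(\Delta_N\otimes\iota)\Delta_N=(\iota\otimes\Delta_N)\Delta_N$; (7) the linear span of $\{\Delta_N(x)(y\otimes z)\mid x\in N,\ y,z\in M\}$ is $\sigma$-weakly dense in $N\bar\otimes N$. Write $\Lambda_N(x)=x\xi_M$ for $x\in N$. There are unitaries $\widetilde V:L^2(N)\otimes L^2(M)\to L^2(N)\otimes L^2(N)$ and $\widetilde W:L^2(N)\otimes L^2(N)\to L^2(M)\otimes L^2(N)$ determined by $\widetilde V(\Lambda_N(x)\otimes\eta)=\Delta_N(x)(\xi_M\otimes\eta)$ and $\widetilde W^*(\eta\otimes\Lambda_N(x))=\Delta_N(x)(\eta\otimes\xi_M)$ for $x\in N$, $\eta\in L^2(M)$; one has $\widetilde V\in B(L^2(N))\bar\otimes N$ and $\widetilde W^*\in N\bar\otimes B(L^2(N))$, and $(\iota\otimes\Delta_N)(\widetilde V)=\widetilde V_{12}\widetilde V_{13}$, $(\Delta_N\otimes\iota)(\widetilde W^* )=\widetilde W_{23}^*\widetilde W_{13}^*$. Put $\widehat N=\{x\in B(L^2(N))\mid\widetilde V^*(x\otimes1)\widetilde V=x\otimes1\}$. It is an $\ell^\infty$-direct sum of type I factors; write $\widehat N=\bigoplus_{r\in I_N}B(\mathcal H_r)$ with $I_N$ countable, $n_r=\dim\mathcal H_r$, and $p_r$ the corresponding minimal central projections. It equals the $\sigma$-weak closure of $\{(\omega\otimes\iota)(\widetilde W)\}$, $\omega\in B(L^2(N),L^2(M))_*$, and $\widetilde W\in N^{\mathrm{op}}\bar\otimes\widehat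 N$. For each $r$ the map $x\mapsto\Sigma\widetilde W(1\otimes x)\widetilde W^*\Sigma$ restricts to an ergodic right coaction $\mathrm{Ad}_R^{(r)}:B(\mathcal H_r)\to B(\mathcal H_r)\bar\otimes M$ (only scalars satisfy $\mathrm{Ad}_R^{(r)}(x)=x\otimes1$). Let $\phi_{N,r}$ be the state on $B(\mathcal H_r)$ with $\phi_{N,r}(x)1=(\iota\otimes\varphi_M)\mathrm{Ad}_R^{(r)}(x)$ and $T_r$ the positive trace class operator with $\phi_{N,r}=\mathrm{Tr}(T_r\,\cdot\,)$. Let $T_{r,0}\ge T_{r,1}\ge\cdots$ be its eigenvalues with multiplicity, $(e_{r,i})_{0\le i<n_r}$ an orthonormal basis of $\mathcal H_r$ with $T_re_{r,i}=T_{r,i}e_{r,i}$, $e_{r,ij}\in\widehat N$ the corresponding matrix units, and $\omega_{r,ij}(x)=\langle xe_{r,i},e_{r,j}\rangle$ for $x\in\widehat N$. *)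

(* Defs.v *)
From HB Require Import structures.
From mathcomp Require Import all_boot all_order all_algebra.
From mathcomp Require Import sesquilinear complex finmap.
From mathcomp Require Import all_classical all_reals topology normedtype sequences.
From mathcomp Require Import summability.

Set Implicit Arguments.
Unset Strict Implicit.
Unset Printing Implicit Defensive.

Import Order.TTheory GRing.Theory Num.Theory.
Import numFieldNormedType.Exports.

Local Open Scope classical_set_scope.
Local Open Scope ring_scope.
Local Open Scope complex_scope.

Record hilbert (R : realType) := Hilbert {
  hilbert_sort :> completeNormedModType R[i];
  hilbert_dot : {dot hilbert_sort for @Num.conj R[i]};
  hilbert_normE : forall a : hilbert_sort, `|a| ^+ 2 = hilbert_dot a a;
  hilbert_separable : exists s : nat -> hilbert_sort, closure (range s) = setT
}.

(* `{dot _ for conj}` is linear in the first variable. *)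
Definition dot (R : realType) (H : hilbert R) (a b : H) : R[i] :=
  hilbert_dot H a b.

Notation "''[' a , b ]" := (dot a b) (format "''[' a ,  b ]") : ring_scope.

Section BoundedOperators.
Variables (R : realType) (H K : hilbert R).

Definition bounded_op_pred : {pred (H -> K)} :=
  fun f => `[< linear f /\ continuous f >].

Lemma bounded_op_submod_closed : submod_closed bounded_op_pred.
Proof.
split.
  apply/asboolP; split; last exact: cst_continuous.
  by move=> k a b; change (0 = k *: 0 + 0 :> K); rewrite scaler0 addr0.
move=> k f g /asboolP[lf cf] /asboolP[lg cg]; apply/asboolP; split.
  move=> l a b.
  change (k *: f (l *: a + b) + g (l *: a + b) =
    l *: (k *: f a + g a) + (k *: f b + g b)).
  by rewrite lf lg !scalerDr addrACA !scalerA (mulrC k).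
move=> a; apply: cvgD; [apply: cvgZl_tmp; exact: cf | exact: cg].
Qed.

HB.instance Definition _ :=
  GRing.isSubmodClosed.Build _ _ bounded_op_pred bounded_op_submod_closed.

Record bounded_op := BoundedOp {
  bounded_op_fun :> H -> K;
  bounded_op_axiom : bounded_op_fun \in bounded_op_pred
}.

HB.instance Definition _ := [isSub for bounded_op_fun].
HB.instance Definition _ := [Choice of bounded_op by <:].
HB.instance Definition _ := [SubChoice_isSubLmodule of bounded_op by <:].

(* [x |-> \sum_n <x (a n), b n>] with [a] and [b] square summable. *)
Definition normal_functional : set (bounded_op -> R[i]) :=
  [set w | exists (a : nat -> H) (b : nat -> K),
    [/\ cvgn (series (fun n => `|a n| ^+ 2 : R[i]^o)),
        cvgn (series (fun n => `|b n| ^+ 2 : R[i]^o)) &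
        forall x : bounded_op,
          series (fun n => '[x (a n), b n] : R[i]^o) @ \oo --> (w x : R[i]^o)]].

(* The topology put on [bounded_op] is the sigma-weak one: below, [closure],
   [closed] and [continuous] on operators always refer to it. *)
Definition sigma_weak_eval (x : bounded_op) :
    prod_topology (fun _ : {w | normal_functional w} => R[i]^o) :=
  fun w => sval w x.

HB.instance Definition _ :=
  Topological.copy bounded_op (initial_topology sigma_weak_eval).

End BoundedOperators.

Notation "''B' ( H , K )" := (bounded_op H K)
  (at level 8, format "''B' ( H ,  K )") : type_scope.
Notation "''B' ( H )" := (bounded_op H H)
  (at level 8, format "''B' ( H )") : type_scope.

Section OperatorAlgebra.
Variable R : realType.
Implicit Types H K L : hilbert R.

Lemma comp_op_subproof H K L (y : 'B(K, L)) (x : 'B(H, K)) :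
  (y : K -> L) \o (x : H -> K) \in @bounded_op_pred R H L.
Proof.
have /asboolP[ly cy] := bounded_op_axiom y.
have /asboolP[lx cx] := bounded_op_axiom x.
apply/asboolP; split => [k a b|a] /=; first by rewrite lx ly.
by apply: continuous_comp; [exact: cx | exact: cy].
Qed.

Definition comp_op H K L (y : 'B(K, L)) (x : 'B(H, K)) : 'B(H, L) :=
  BoundedOp (comp_op_subproof y x).

Lemma id_op_subproof H : (id : H -> H) \in @bounded_op_pred R H H.
Proof. by apply/asboolP; split => // a; exact: cvg_id. Qed.

Definition id_op H : 'B(H) := BoundedOp (id_op_subproof H).

(* Junk value 0 when no operator satisfies [P].  In each use below at most one
   operator satisfies [P], and existence is standard: by Riesz representation
   for [adj] and the slices, by extension from elementary tensors for
   [tensor_op], [flip] and [assoc]. *)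
Definition the_op H K (P : set 'B(H, K)) : 'B(H, K) := xget 0 P.

Definition adj H K (x : 'B(H, K)) : 'B(K, H) :=
  the_op [set y | forall a b, '[x a, b] = '[a, y b]].

Definition rank_one H K (a : K) (b : H) : 'B(H, K) :=
  the_op [set x | forall c, x c = '[c, b] *: a].

Definition is_unitary H K (u : 'B(H, K)) : Prop :=
  comp_op (adj u) u = id_op H /\ comp_op u (adj u) = id_op K.

Definition positive_op H (x : 'B(H)) : Prop := forall a, 0 <= '[x a, a].

Definition lspan (V : lmodType R[i]) (A : set V) : set V :=
  [set v | exists (n : nat) (c : 'I_n -> R[i]) (w : 'I_n -> V),
     (forall i, A (w i)) /\ v = \sum_i c i *: w i].

Definition linear_subspace (V : lmodType R[i]) (A : set V) : Prop :=
  A 0 /\ forall k v w, A v -> A w -> A (k *: v + w).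

Definition linear_on (V W : lmodType R[i]) (A : set V) (f : V -> W) : Prop :=
  forall k v w, A v -> A w -> f (k *: v + w) = k *: f v + f w.

Definition normal_on H K H' K' (A : set 'B(H, K)) (f : 'B(H, K) -> 'B(H', K'))
  : Prop := {within A, continuous f}.

Record unital_star_hom H K (A : set 'B(H)) (f : 'B(H) -> 'B(K)) : Prop := {
  ush_linear : linear_on A f;
  ush_mul : forall x y, A x -> A y -> f (comp_op x y) = comp_op (f x) (f y);
  ush_adj : forall x, A x -> f (adj x) = adj (f x);
  ush_unit : f (id_op H) = id_op K
}.

Record von_neumann_algebra H (M : set 'B(H)) : Prop := {
  vna_subspace : linear_subspace M;
  vna_unit : M (id_op H);
  vna_mul : forall x y, M x -> M y -> M (comp_op x y);
  vna_adj : forall x, M x -> M (adj x);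
  vna_closed : closed M
}.

Record is_state H (A : set 'B(H)) (f : 'B(H) -> R[i]) : Prop := {
  state_linear : forall k x y, A x -> A y -> f (k *: x + y) = k * f x + f y;
  state_positive : forall x, A x -> 0 <= f (comp_op (adj x) x);
  state_unit : f (id_op H) = 1
}.

Definition strong_cvg H K (T : Type) (F : set_system T)
    (x : T -> 'B(H, K)) (y : 'B(H, K)) : Prop :=
  forall a : H, (fun t => x t a) @ F --> y a.

Definition strong_star_cvg H K (T : Type) (F : set_system T)
    (x : T -> 'B(H, K)) (y : 'B(H, K)) : Prop :=
  strong_cvg F x y /\ strong_cvg F (fun t => adj (x t)) (adj y).

(* A dimension in [{0, 1, ...} + {oo}]; [None] stands for infinity. *)
Definition below (n : option nat) (i : nat) : bool :=
  if n is Some m then (i < m)%N else true.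

(* Only the vectors [e i] with [i < n] matter. *)
Definition orthonormal_basis H (n : option nat) (e : nat -> H) : Prop :=
  (forall i j, below n i -> below n j -> '[e i, e j] = (i == j)%:R) /\
  closure (lspan [set e i | i in [set i | below n i]]) = setT.

Definition has_trace H (x : 'B(H)) (c : R[i]) : Prop :=
  forall (n : option nat) (e : nat -> H), orthonormal_basis n e ->
    (fun m : nat => \sum_(k < m | below n k) '[x (e k), e k] : R[i]^o)
      @ \oo --> (c : R[i]^o).

Definition positive_trace_class H (x : 'B(H)) : Prop :=
  positive_op x /\ exists c, has_trace x c.

Definition uniformly_bounded (I : Type) (H : I -> hilbert R)
    (y : forall r, 'B(H r)) : Prop :=
  exists c : R, forall r a, `|y r a| <= c%:C * `|a|.

(* [x |-> (pi r x)_r] is an isomorphism of von Neumann algebras from [A] onto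
   the l^oo-direct sum of the [B(H r)]. *)
Record linfty_sum_decomposition K (A : set 'B(K)) (I : Type)
    (H : I -> hilbert R) (pi : forall r, 'B(K) -> 'B(H r)) : Prop := {
  lsd_nonzero : forall r, exists a : H r, a != 0;
  lsd_hom : forall r, unital_star_hom A (pi r);
  lsd_normal : forall r, normal_on A (pi r);
  lsd_bounded : forall x, A x -> uniformly_bounded (fun r => pi r x);
  lsd_inj : forall x, A x -> (forall r, pi r x = 0) -> x = 0;
  lsd_surj : forall y : (forall r, 'B(H r)), uniformly_bounded y ->
    exists2 x, A x & forall r, pi r x = y r
}.

(* The inclusion [B(H r) -> A], so that [summand_incl A pi r 1] is the minimal
   central projection of index [r]. *)
Definition summand_incl K (A : set 'B(K)) (I : Type) (H : I -> hilbert R)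
    (pi : forall r, 'B(K) -> 'B(H r)) (r : I) (y : 'B(H r)) : 'B(K) :=
  the_op [set x | [/\ A x, pi r x = y & forall s, s <> r -> pi s x = 0]].

Arguments summand_incl {K} A {I H} pi r y.

End OperatorAlgebra.

Arguments summand_incl {R K} A {I H} pi r y.

Notation "y '∘' x" := (comp_op y x) (at level 40, left associativity)
  : ring_scope.
Notation "'𝟙'" := (id_op _) : ring_scope.

Record hilbert_tensor (R : realType) (H K : hilbert R) := HilbertTensor {
  tensor_space :> hilbert R;
  tensor_pure : {bilinear H -> K -> tensor_space};
  tensor_dot : forall a b c d,
    '[tensor_pure a b, tensor_pure c d] = '[a, c] * '[b, d];
  tensor_total :
    closure (lspan [set tensor_pure a b | a in setT & b in setT]) = setT
}.

(* A realisation of all Hilbert space tensor products: each of them is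
   determined by [hilbert_tensor] up to a unique unitary, so that quantifying
   over [tensor_products R] fixes an arbitrary model. *)
Class tensor_products (R : realType) :=
  tensor_of : forall H K : hilbert R, hilbert_tensor H K.

Notation "H ⊗ K" := (tensor_space (tensor_of H K))
  (at level 40, left associativity) : type_scope.
Notation "a ⊗ᵥ b" := (tensor_pure (tensor_of _ _) a b)
  (at level 40, left associativity) : ring_scope.

Section Tensor.
Context {R : realType} {tp : tensor_products R}.
Implicit Types H K L : hilbert R.

Definition tensor_op H K H' K' (x : 'B(H, H')) (y : 'B(K, K')) :
    'B(H ⊗ K, H' ⊗ K') :=
  the_op [set z | forall a b, z (a ⊗ᵥ b) = x a ⊗ᵥ y b].

Definition flip H K : 'B(H ⊗ K, K ⊗ H) :=
  the_op [set z | forall a b, z (a ⊗ᵥ b) = b ⊗ᵥ a].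

Definition assoc H K L : 'B((H ⊗ K) ⊗ L, H ⊗ (K ⊗ L)) :=
  the_op [set z | forall a b c, z ((a ⊗ᵥ b) ⊗ᵥ c) = a ⊗ᵥ (b ⊗ᵥ c)].

(* [(ι ⊗ ω_(c,d))(X)] and [(ω_(a,b) ⊗ ι)(X)], with [ω_(c,d)(x) = <x c, d>] *)
Definition slice_r_vec H K H' K' (c : K) (d : K') (X : 'B(H ⊗ K, H' ⊗ K')) :
    'B(H, H') :=
  the_op [set z | forall a b, '[z a, b] = '[X (a ⊗ᵥ c), b ⊗ᵥ d]].

Definition slice_l_vec H K H' K' (a : H) (b : H') (X : 'B(H ⊗ K, H' ⊗ K')) :
    'B(K, K') :=
  the_op [set z | forall c d, '[z c, d] = '[X (a ⊗ᵥ c), b ⊗ᵥ d]].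

(* [(ι ⊗ w)(X)] and [(w ⊗ ι)(X)]; [w] is only evaluated at slices of [X], so
   it need only be meaningful on a space containing the relevant leg of [X]. *)
Definition slice_r H K H' K' (w : 'B(K, K') -> R[i])
    (X : 'B(H ⊗ K, H' ⊗ K')) : 'B(H, H') :=
  the_op [set z | forall a b, '[z a, b] = w (slice_l_vec a b X)].

Definition slice_l H K H' K' (w : 'B(H, H') -> R[i])
    (X : 'B(H ⊗ K, H' ⊗ K')) : 'B(K, K') :=
  the_op [set z | forall c d, '[z c, d] = w (slice_r_vec c d X)].

Definition tensor_space_op H K H' K' (A : set 'B(H, H')) (B : set 'B(K, K')) :
    set 'B(H ⊗ K, H' ⊗ K') :=
  closure (lspan [set tensor_op x y | x in A & y in B]).

(* [F] is [f ⊗ g], the normal extension of [x ⊗ y |-> f x ⊗ g y] *)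
Record is_tensor_map H H' K K' L L' S S'
    (A : set 'B(H, H')) (B : set 'B(K, K'))
    (f : 'B(H, H') -> 'B(L, L')) (g : 'B(K, K') -> 'B(S, S'))
    (F : 'B(H ⊗ K, H' ⊗ K') -> 'B(L ⊗ S, L' ⊗ S')) : Prop := {
  itm_linear : linear_on (tensor_space_op A B) F;
  itm_normal : normal_on (tensor_space_op A B) F;
  itm_pure : forall x y, A x -> B y -> F (tensor_op x y) = tensor_op (f x) (g y)
}.

Definition coassociative H K (A : set 'B(H, K))
    (D : 'B(H, K) -> 'B(H ⊗ H, K ⊗ K)) : Prop :=
  exists (F : 'B(H ⊗ H, K ⊗ K) -> 'B((H ⊗ H) ⊗ H, (K ⊗ K) ⊗ K))
         (G : 'B(H ⊗ H, K ⊗ K) -> 'B(H ⊗ (H ⊗ H), K ⊗ (K ⊗ K))),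
    [/\ is_tensor_map A A D id F, is_tensor_map A A id D G &
        forall x, A x -> assoc K K K ∘ F (D x) = G (D x) ∘ assoc H H H].

Record von_neumann_bialgebra H (M : set 'B(H)) (D : 'B(H) -> 'B(H ⊗ H)) :
    Prop := {
  vnb_algebra : von_neumann_algebra M;
  vnb_range : forall x, M x -> tensor_space_op M M (D x);
  vnb_hom : unital_star_hom M D;
  vnb_normal : normal_on M D;
  vnb_faithful : forall x, M x -> D x = 0 -> x = 0;
  vnb_coassociative : coassociative M D
}.

Definition vector_functional H (xi : H) (x : 'B(H)) : R[i] := '[x xi, xi].

(* [M] is given in the GNS representation of its invariant state: [H] is
   L^2(M), and the invariant state is the vector state of [xi]. *)
Record compact_woronowicz H (M : set 'B(H)) (D : 'B(H) -> 'B(H ⊗ H)) (xi : H)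
    : Prop := {
  cwa_bialgebra : von_neumann_bialgebra M D;
  cwa_unit_vector : '[xi, xi] = 1;
  cwa_cyclic : closure [set x xi | x in M] = setT;
  cwa_separating : forall x, M x -> x xi = 0 -> x = 0;
  cwa_invariant_l : forall x, M x ->
    slice_l (vector_functional xi) (D x) = vector_functional xi x *: 𝟙;
  cwa_invariant_r : forall x, M x ->
    slice_r (vector_functional xi) (D x) = vector_functional xi x *: 𝟙
}.

Definition opposite_space H K (N : set 'B(H, K)) : set 'B(K, H) :=
  [set adj x | x in N].

Record right_galois_coobject H K
    (M : set 'B(H)) (DM : 'B(H) -> 'B(H ⊗ H))
    (N : set 'B(H, K)) (DN : 'B(H, K) -> 'B(H ⊗ H, K ⊗ K)) : Prop := {
  rgc_subspace : linear_subspace N;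
  rgc_closed : closed N;
  rgc_range : forall x, N x -> tensor_space_op N N (DN x);
  rgc_linear : linear_on N DN;
  rgc_normal : normal_on N DN;
  rgc_dense : closure (lspan [set (x : 'B(H, K)) a | x in N & a in setT]) = setT;
  rgc_op_dense : closure
    (lspan [set (x : 'B(K, H)) a | x in opposite_space N & a in setT]) = setT;
  rgc_module : forall x y, N x -> M y -> N (x ∘ y);
  rgc_inner : forall x y, N x -> N y -> M (adj x ∘ y);
  rgc_mul : forall x y, N x -> M y -> DN (x ∘ y) = DN x ∘ DM y;
  rgc_adj_mul : forall x y, N x -> N y -> adj (DN x) ∘ DN y = DM (adj x ∘ y);
  rgc_coassociative : coassociative N DN;
  rgc_total : closure (lspan
      [set w | exists x y z, [/\ N x, M y, M z & w = DN x ∘ tensor_op y z]]) =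
    tensor_space_op N N
}.

Record is_Vtilde H K (xi : H) (N : set 'B(H, K))
    (DN : 'B(H, K) -> 'B(H ⊗ H, K ⊗ K)) (V : 'B(K ⊗ H, K ⊗ K)) : Prop := {
  vt_unitary : is_unitary V;
  vt_eq : forall x a, N x -> V (x xi ⊗ᵥ a) = DN x (xi ⊗ᵥ a)
}.

Record is_Wtilde H K (xi : H) (N : set 'B(H, K))
    (DN : 'B(H, K) -> 'B(H ⊗ H, K ⊗ K)) (W : 'B(K ⊗ K, H ⊗ K)) : Prop := {
  wt_unitary : is_unitary W;
  wt_eq : forall x a, N x -> adj W (a ⊗ᵥ x xi) = DN x (a ⊗ᵥ xi)
}.

Definition dual_algebra H K (V : 'B(K ⊗ H, K ⊗ K)) : set 'B(K) :=
  [set x | adj V ∘ tensor_op x 𝟙 ∘ V = tensor_op x 𝟙].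

(* [x |-> Σ W (1 ⊗ x) W^* Σ] *)
Definition Ad_R H K (W : 'B(K ⊗ K, H ⊗ K)) (x : 'B(K)) : 'B(K ⊗ H) :=
  flip H K ∘ W ∘ tensor_op 𝟙 x ∘ adj W ∘ flip K H.

(* [phi] is the state on [B(L r)] with
   [phi(y) 1 = (ι ⊗ φ_M)(Ad_R^(r)(y))], where [B(L r)] is identified with a
   direct summand of [A] and its unit [1] with a central projection. *)
Record is_invariant_state H K (xi : H) (W : 'B(K ⊗ K, H ⊗ K)) (A : set 'B(K))
    (I : Type) (L : I -> hilbert R) (pi : forall r, 'B(K) -> 'B(L r)) (r : I)
    (phi : 'B(L r) -> R[i]) : Prop := {
  inv_state : is_state setT phi;
  inv_eq : forall y,
    slice_r (vector_functional xi) (Ad_R W (summand_incl A pi r y)) =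
    phi y *: summand_incl A pi r 𝟙
}.

(* [W_(r,ij) = (ι ⊗ ω_(r,ji))(W)] with [ω_(r,ji)(x) = <x e_(r,j), e_(r,i)>] *)
Definition W_coef H K (W : 'B(K ⊗ K, H ⊗ K))
    (I : Type) (L : I -> hilbert R) (pi : forall r, 'B(K) -> 'B(L r))
    (e : forall r, nat -> L r) (r : I) (i j : nat) : 'B(K, H) :=
  slice_r (fun x => '[pi r x (e r j), e r i]) W.

(* [e_(r,ij)], sending [e_(r,j)] to [e_(r,i)] *)
Definition matrix_unit K (A : set 'B(K))
    (I : Type) (L : I -> hilbert R) (pi : forall r, 'B(K) -> 'B(L r))
    (e : forall r, nat -> L r) (r : I) (i j : nat) : 'B(K) :=
  summand_incl A pi r (rank_one (e r i) (e r j)).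

End Tensor.

Notation "x ⊗ₒ y" := (tensor_op x y) (at level 40, left associativity)
  : ring_scope.

(* Main.v *)
(* Each block of the dual algebra [A] acts on [L2N] through an isometric copy of
   [H r], the orbit under the matrix units of a unit vector in the range of a
   minimal projection.  Hence the functional defining [W_(r,ij)] is a vector
   functional of [L2N], [W_(r,ij) = (ι ⊗ ω_(f_j,f_i))(W)] for an orthonormal family
   [f], and every infinite sum becomes a compression of [W] or [W^*] by the
   increasing projections [1 ⊗ \sum_(k < m) e_(r,kk)].

   Evaluating [(Δ_N ⊗ ι)Δ_N = (ι ⊗ Δ_N)Δ_N] at vectors with a leg [xi] shows that
   each slice [x] of [W] satisfies [(x ⊗ 1)V = V(x ⊗ 1)], that is, lies in [A], and
   computes [Δ_N] on the slices of [W^*].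

   In the orthogonality relations, the case [r = s] is the invariance of [phi_r].
   For [r <> s], [W^*(xi ⊗ c) = V(c ⊗ xi)] and [V] commutes with the central
   projections, so [W_(r,ij)^* xi] lies in the range of [p_r]. *)
Require Import Defs.
From HB Require Import structures.
From mathcomp Require Import all_boot all_order all_algebra.
From mathcomp Require Import sesquilinear complex finmap.
From mathcomp Require Import all_classical all_reals topology normedtype sequences.
From mathcomp Require Import summability.
From mathcomp Require Import ring.
Import Order.TTheory GRing.Theory Num.Theory.
Import numFieldNormedType.Exports.
Local Open Scope classical_set_scope.
Local Open Scope ring_scope.
Set Implicit Arguments.
Unset Strict Implicit.
Unset Printing Implicit Defensive.

(** * Operators on Hilbert spaces *)

(** The operators [adj], [rank_one], [tensor_op], [flip], [assoc] and all slices are [the_op] of a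
    specification, hence 0 until a solution is exhibited. This shapes the first half: Riesz
    representation yields adjoints, a Gram-Schmidt estimate yields [x ⊗ 1], and isometric extension
    yields [flip] and [assoc]. [Δ_N ⊗ ι] and [ι ⊗ Δ_N] are known only as linear maps on the
    sigma-weakly closed span of [N ⊗ N], continuous relative to it. Identities about them are tested
    on elementary tensors after pairing with fixed vectors, which turns both sides into scalar forms
    ([normal_form_eq]). [V] and [W^*] are prescribed only at vectors [x xi] with [x] in [N]; density
    of [N xi] and closedness of [N] carry the formulas to slices at arbitrary vectors. That [e r]
    diagonalises [T r] enters only in the last step, the evaluation of [Tr(T_r e_(r,jl))]; until
    then any orthonormal basis would do. *)

Section InnerProduct.
Context {R : realType} {H : hilbert R}.
Implicit Types (a b c : H) (k : R[i]).

Lemma dotDl a b c : '[a + b, c] = '[a, c] + '[b, c].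
Proof. exact: linearDl. Qed.
Lemma dotDr a b c : '[a, b + c] = '[a, b] + '[a, c].
Proof. exact: linearDr. Qed.
Lemma dotNr a b : '[a, - b] = - '[a, b].
Proof. exact: linearNr. Qed.
Lemma dotBl a b c : '[a - b, c] = '[a, c] - '[b, c].
Proof. exact: linearBl. Qed.
Lemma dotBr a b c : '[a, b - c] = '[a, b] - '[a, c].
Proof. exact: linearBr. Qed.
Lemma dotZl k a b : '[k *: a, b] = k * '[a, b].
Proof. exact: linearZl_LR. Qed.
Lemma dotZr k a b : '[a, k *: b] = k^* * '[a, b].
Proof. exact: linearZr_LR. Qed.
Lemma dot0l a : '[0 : H, a] = 0.
Proof. exact: linear0l. Qed.
Lemma dot0r a : '[a, 0 : H] = 0.
Proof. exact: linear0r. Qed.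
Lemma dot_suml (J : Type) (r : seq J) (P : pred J) (F : J -> H) a :
  '[\sum_(j <- r | P j) F j, a] = \sum_(j <- r | P j) '[F j, a].
Proof. exact: linear_sumlz. Qed.
Lemma dot_sumr (J : Type) (r : seq J) (P : pred J) (F : J -> H) a :
  '[a, \sum_(j <- r | P j) F j] = \sum_(j <- r | P j) '[a, F j].
Proof. exact: linear_sumr. Qed.
Lemma dotC a b : '[b, a] = '[a, b]^*.
Proof. by rewrite /dot hermC mul1r. Qed.
Lemma dotaa a : '[a, a] = `|a| ^+ 2.
Proof. by rewrite hilbert_normE. Qed.

Lemma dot_eq0 a : (forall b, '[a, b] = 0) -> a = 0.
Proof.
by move=> /(_ a); rewrite dotaa => /eqP; rewrite sqrf_eq0 normr_eq0 => /eqP.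
Qed.

Lemma dot_inj a b : (forall c, '[a, c] = '[b, c]) -> a = b.
Proof.
move=> ab; apply/subr0_eq/dot_eq0 => c; by rewrite dotBl ab subrr.
Qed.

Lemma dot_injr a b : (forall c, '[c, a] = '[c, b]) -> a = b.
Proof. by move=> ab; apply: dot_inj => c; rewrite dotC ab -dotC. Qed.

Lemma normD_sqr a b :
  `|a + b| ^+ 2 = `|a| ^+ 2 + `|b| ^+ 2 + ('[a, b] + '[a, b]^*).
Proof.
by rewrite -!dotaa dotDl !dotDr (dotC a b); ring.
Qed.

Lemma norm_orthoD a b : '[a, b] = 0 -> `|a + b| ^+ 2 = `|a| ^+ 2 + `|b| ^+ 2.
Proof. by move=> ab; rewrite normD_sqr ab conjC0 !addr0. Qed.

Lemma parallelogram a b :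
  `|a - b| ^+ 2 = `|a| ^+ 2 *+ 2 + `|b| ^+ 2 *+ 2 - `|a + b| ^+ 2.
Proof.
rewrite !normD_sqr normrN dotNr rmorphN /= opprD.
ring.
Qed.

Lemma dot_le a b : `|'[a, b]| <= `|a| * `|b|.
Proof.
have [->|b0] := eqVneq b 0; first by rewrite dot0r !normr0 mulr0.
have n0 : 0 < `|b| by rewrite normr_gt0.
rewrite -(@ler_pXn2r _ 2) ?nnegrE ?mulr_ge0 //.
(* This vector is [|b|^2] times the component of [a] orthogonal to [b], a scaling that avoids
   division. *)
have := dnorm_ge0 (hilbert_dot H) (`|b| ^+ 2 *: a - '[a, b] *: b).
rewrite -/(dot _ _) dotBl !dotBr !dotZl !dotZr !dotaa (dotC a b) rmorphXn /=.
rewrite (CrealP (normr_real _)) normCK.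
set x := `|b| ^+ 2; set u := '[a, b].
have x0 : 0 < x by rewrite exprn_gt0.
have -> : x * (x * `|a| ^+ 2) - x * (u^* * u) - (u * (x * u^*) - u * (u^* * x)) =
  x * (`|a| ^+ 2 * x - u * u^*) by ring.
by rewrite pmulr_rge0 // subr_ge0 exprMn.
Qed.

End InnerProduct.

Section Operators.
Context {R : realType}.
Implicit Types H K L : hilbert R.

Lemma op_linear H K (x : 'B(H, K)) : linear x.
Proof. by have /asboolP[] := bounded_op_axiom x. Qed.

HB.instance Definition _ H K (x : 'B(H, K)) :=
  @GRing.isLinear.Build R[i] H K _ x (op_linear x).

Lemma op_continuous H K (x : 'B(H, K)) : continuous (x : H -> K).
Proof. by have /asboolP[] := bounded_op_axiom x. Qed.

Lemma op_cvg H K (x : 'B(H, K)) (T : Type) (F : set_system T) {FF : Filter F}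
    (u : T -> H) a :
  u t @[t --> F] --> a -> x (u t) @[t --> F] --> x a.
Proof. by move=> ua; apply: continuous_cvg => //; exact: op_continuous. Qed.

Lemma op_ext H K (x y : 'B(H, K)) : (forall a, x a = y a) -> x = y.
Proof. by move=> xy; apply/val_inj/funext. Qed.

Lemma opDE H K (x y : 'B(H, K)) a : (x + y) a = x a + y a. Proof. by []. Qed.
Lemma opBE H K (x y : 'B(H, K)) a : (x - y) a = x a - y a. Proof. by []. Qed.
Lemma op0E H K a : (0 : 'B(H, K)) a = 0. Proof. by []. Qed.
Lemma opZE H K k (x : 'B(H, K)) a : (k *: x) a = k *: x a. Proof. by []. Qed.

Lemma op_sumE H K (J : Type) (r : seq J) (P : pred J) (F : J -> 'B(H, K)) a :
  (\sum_(j <- r | P j) F j) a = \sum_(j <- r | P j) F j a.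
Proof. by elim/big_rec2: _ => // j y x _ <-. Qed.

Lemma op0 H K (x : 'B(H, K)) : x 0 = 0. Proof. exact: linear0. Qed.
Lemma opD H K (x : 'B(H, K)) a b : x (a + b) = x a + x b. Proof. exact: linearD. Qed.
Lemma opB H K (x : 'B(H, K)) a b : x (a - b) = x a - x b. Proof. exact: linearB. Qed.
Lemma opZ H K (x : 'B(H, K)) k a : x (k *: a) = k *: x a. Proof. exact: linearZ. Qed.
Lemma op_sum H K (x : 'B(H, K)) (J : Type) (r : seq J) (P : pred J) (F : J -> H) :
  x (\sum_(j <- r | P j) F j) = \sum_(j <- r | P j) x (F j).
Proof. exact: linear_sum. Qed.

Lemma op_bound H K (x : 'B(H, K)) :
  exists2 c : R[i], 0 <= c & forall a, `|x a| <= c * `|a|.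
Proof.
have /linear_boundedP : bounded_near x (nbhs (0 : H)).
  by apply: continuous_linear_bounded; exact: op_continuous.
move=> [c [cr hc]].
exists (`|c| + 1); first by rewrite addr_ge0.
by move=> a; apply: hc; rewrite (le_lt_trans (real_ler_norm cr)) // ltrDl.
Qed.

Lemma bounded_linear_op H K (f : H -> K) (c : R[i]) : 0 <= c ->
  linear f -> (forall a, `|f a| <= c * `|a|) -> exists x : 'B(H, K), forall a, x a = f a.
Proof.
move=> c0 lf fc.
pose g : {linear H -> K} := HB.pack f (GRing.isLinear.Build R[i] H K _ f lf).
have cg : continuous g.
  apply: bounded_linear_continuous; apply/linear_boundedP.
  exists c; split => [|d cd a]; first exact: ger0_real.
  by apply: le_trans (fc a) _; apply: ler_wpM2r => //; exact: ltW.
have fP : f \in @bounded_op_pred R H K by apply/asboolP; split.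
by exists (BoundedOp fP).
Qed.

Lemma cvg_dotl H (T : Type) (F : set_system T) {FF : Filter F} (u : T -> H) a b :
  u t @[t --> F] --> a -> ('[u t, b] : R[i]^o) @[t --> F] --> ('[a, b] : R[i]^o).
Proof.
move=> /cvgrPdist_lt ua; apply/cvgrPdist_lt => e e0.
have e1 : 0 < e / (`|b| + 1) by rewrite divr_gt0 // ltr_wpDl.
near=> t; rewrite -dotBl (le_lt_trans (dot_le _ _)) //.
rewrite (@le_lt_trans _ _ (`|a - u t| * (`|b| + 1))) ?ler_wpM2l ?lerDl//.
by rewrite -ltr_pdivlMr ?ltr_wpDl //; near: t; exact: ua.
Unshelve. all: by end_near. Qed.

End Operators.

(** The order of [R[i]] is only partial, but nonnegative elements are real, so the infimum can be
    taken in [R] and mapped back. *)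
Lemma nonneg_inf {R : realType} (S : set R[i]) :
  S !=set0 -> (forall z, S z -> 0 <= z) ->
  exists d : R[i], [/\ 0 <= d, forall z, S z -> d <= z &
    forall e, 0 < e -> exists2 z, S z & z < d + e].
Proof.
move=> [z0 Sz0] S0; pose E := [set x : R | S (x%:C)%C].
have realE (z : R[i]) : 0 <= z -> z = ((complex.Re z)%:C)%C.
  by move=> z0'; rewrite RRe_real // ger0_real.
have hE : has_inf E.
  split; first by exists (complex.Re z0); rewrite /E /= -realE //; exact: S0.
  by exists 0 => x /S0; rewrite -[0 in X in X -> _]/((0 : R)%:C)%C lecR.
exists (inf E)%:C%C; split.
- rewrite -[X in X <= _]/((0 : R)%:C)%C lecR; apply: lb_le_inf; first by case: hE.
  by move=> x /S0; rewrite -[X in X <= _ -> _]/((0 : R)%:C)%C lecR.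
- move=> z Sz; rewrite (realE _ (S0 _ Sz)) lecR; apply: ge_inf; first by case: hE.
  by rewrite /E /= -realE // S0.
move=> e e0; rewrite (realE e) ?ltW //.
have : 0 < complex.Re e by rewrite -ltcR -realE ?ltW.
move=> /(inf_adherent)/(_ hE)[x Ex xe]; exists x%:C%C => //.
by rewrite -rmorphD /= ltcR.
Qed.

Lemma hilbert_cauchy_cvg {R : realType} (H : hilbert R) (T : Type)
    (F : set_system T) {FF : ProperFilter F} (u : T -> H) :
  (forall e : R[i], 0 < e -> exists a, \forall t \near F, `|a - u t| < e) ->
  cvg (u t @[t --> F]).
Proof.
move=> uC; apply: cauchy_cvg; apply: cauchy_exP => e e0.
have [a au] := uC _ e0; exists a; near=> t.
by rewrite -ball_normE; near: t.
Unshelve. all: by end_near. Qed.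

(** Serves for filters of approximate solutions, indexed by the error [e]. Positive elements of
    [R[i]] are real, hence comparable, so two errors have a minimum. *)
Lemma filter_from_pos {R : realType} (T : Type) (B : R[i] -> set T) :
  (forall e1 e2, e1 <= e2 -> B e1 `<=` B e2) ->
  (forall e, 0 < e -> B e !=set0) ->
  ProperFilter (filter_from [set e : R[i] | 0 < e] B).
Proof.
move=> Bmono B0; apply: filter_from_proper => //.
apply: filter_from_filter; first by exists 1; exact: ltr01.
move=> e1 e2 /= e10 e20.
have cmp : (e1 >=< e2)%O by rewrite real_comparable // gtr0_real.
exists (Order.min e1 e2) => [/=|a aB]; first by case: (comparable_leP cmp).
split; apply: Bmono aB; first by rewrite comparable_ge_min // lexx.
by rewrite comparable_ge_min // lexx orbT.
Qed.

Section Riesz.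
Context {R : realType} {H : hilbert R}.

Lemma norm_sub_proj (a h : H) : h != 0 ->
  `|a - ('[a, h] / `|h| ^+ 2) *: h| ^+ 2 = `|a| ^+ 2 - `|'[a, h]| ^+ 2 / `|h| ^+ 2.
Proof.
move=> h0; have hn : `|h| ^+ 2 != 0 by rewrite expf_eq0 normr_eq0.
rewrite normD_sqr normrN normrZ dotNr dotZr exprMn normf_div normrX normr_id.
rewrite !rmorphN !rmorphM /= fmorphV rmorphXn /=.
rewrite !(CrealP (normr_real _)) conjCK fmorphV rmorphXn /=.
rewrite !(CrealP (normr_real _)) expr_div_n normCK; field.
by move: hn; rewrite expf_eq0.
Qed.

(* A vector of minimal norm on the hyperplane [f = 1] is orthogonal to the
   kernel of [f]; it is the limit of the filter of almost minimal vectors. *)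
Lemma riesz (f : H -> R[i]) (c : R[i]) : 0 <= c ->
  (forall k a b, f (k *: a + b) = k * f a + f b) ->
  (forall a, `|f a| <= c * `|a|) -> exists b, forall a, f a = '[a, b].
Proof.
move=> c0 lf fc.
have fD a b : f (a + b) = f a + f b by rewrite -[a]scale1r lf mul1r scale1r.
have f0 : f 0 = 0 by apply/eqP; rewrite -normr_le0 (le_trans (fc _)) // normr0 mulr0.
have fZ k a : f (k *: a) = k * f a by rewrite -[k *: a]addr0 lf f0 addr0.
have fB a b : f (a - b) = f a - f b by rewrite fD -scaleN1r fZ mulN1r.
have [fz|] := pselect (forall a, f a = 0); first by exists 0 => a; rewrite dot0r.
move=> /existsNP[a0 /eqP fa0].
pose S := [set `|a| ^+ 2 | a in [set a : H | f a = 1]].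
have [||d [d0 dS Sd]] := @nonneg_inf R S.
- by exists (`|(f a0)^-1 *: a0| ^+ 2), ((f a0)^-1 *: a0) => //=; rewrite fZ mulVf.
- by move=> _ [a _ <-]; rewrite exprn_ge0.
pose B (e : R[i]) := [set a : H | f a = 1 /\ `|a| ^+ 2 < d + e].
pose G := filter_from [set e : R[i] | 0 < e] B.
have FG : ProperFilter G.
  apply: filter_from_pos => [e1 e2 e12 a [fa ad]|e /Sd[_ [a fa <-] ae]]; last by exists a.
  by split=> //; rewrite (lt_le_trans ad) // lerD2l.
(* The midpoint of [a] and [b] stays on the hyperplane, so [|a + b|^2 >= 4 d]; the parallelogram law
   does the rest. *)
have near_sub e1 e2 a b : B e1 a -> B e2 b -> `|a - b| ^+ 2 < e1 *+ 2 + e2 *+ 2.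
  move=> [fa ae] [fb be]; rewrite parallelogram.
  have : d <= `|2^-1 *: (a + b)| ^+ 2.
    by apply: dS; exists (2^-1 *: (a + b)) => //=; rewrite fZ fD fa fb mulVf ?pnatr_eq0.
  rewrite normrZ exprMn ger0_norm ?invr_ge0 ?ler0n // => dab.
  have : d *+ 2 + d *+ 2 <= `|a + b| ^+ 2.
    move: dab; rewrite exprVn ler_pdivlMl ?exprn_gt0 ?ltr0n //.
    by have -> : 2%:R ^+ 2 * d = d *+ 2 + d *+ 2 by ring.
  move=> h; rewrite ltrBlDr.
  have aeb : `|a| ^+ 2 *+ 2 + `|b| ^+ 2 *+ 2 < (d + e1) *+ 2 + (d + e2) *+ 2.
    by rewrite ltrD ?ltrMn2r.
  by apply: lt_le_trans aeb _; rewrite !mulrnDl addrACA addrC lerD2l.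
have GC : cvg (idfun x @[x --> G]).
  apply: (@hilbert_cauchy_cvg _ H _ G) => e e0.
  (* With both errors equal to [e'], [near_sub] gives exactly the bound [e ^+ 2]. *)
  pose e' := e ^+ 2 / 4.
  have e'0 : 0 < e' by rewrite divr_gt0 // exprn_gt0.
  have [_ [a fa <-] ae] := Sd _ e'0; exists a, e' => //= b bB.
  have : B e' a by split.
  move=> /near_sub/(_ bB); rewrite -mulrnDr -mulr_natr divfK ?pnatr_eq0 // => h.
  by rewrite -(@ltr_pXn2r _ 2) ?nnegrE // ltW.
have /cvg_ex[b Gb] := GC.
have cp1 : 0 < c + 1 by rewrite ltr_wpDl ?ltr01.
have fb : f b = 1.
  apply/eqP; rewrite -subr_eq0 -normr_le0; apply/ler_addgt0Pr => e e0.
  rewrite add0r; have [] := @filter_ex _ G _ (fun a => f a = 1 /\ `|b - a| < e / (c + 1)).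
    apply: filterI; first by exists 1 => [|a []] /=.
    have /cvgrPdist_lt := Gb; apply; by rewrite divr_gt0 // ltr_wpDl.
  move=> a [fa ba]; rewrite -[X in _ - X]fa -fB (le_trans (fc _)) //.
  rewrite (@le_trans _ _ ((c + 1) * `|b - a|)) ?ler_wpM2r ?lerDl ?ler01 //.
  by rewrite mulrC -ler_pdivlMr // ltW.
(* Subtracting from [a] its component along [h] stays on the hyperplane, so almost minimality of [a]
   forces ['[a, h]] to be small. *)
have ob h : f h = 0 -> '[b, h] = 0.
  move=> fh; have [->|h0] := eqVneq h 0; first by rewrite dot0r.
  have h1 : 0 < `|h| ^+ 2 by rewrite exprn_gt0 // normr_gt0.
  have c1 : ('[a, h] : R[i]^o) @[a --> G] --> ('[b, h] : R[i]^o) by exact: cvg_dotl.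
  have c2 : ('[a, h] : R[i]^o) @[a --> G] --> (0 : R[i]^o).
    apply/cvgrPdist_lt => e e0; exists (e ^+ 2 / `|h| ^+ 2).
      by rewrite /= divr_gt0 // exprn_gt0.
    move=> a [fa ade] /=; rewrite sub0r normrN.
    rewrite -(@ltr_pXn2r _ 2) ?nnegrE ?(ltW e0) //.
    rewrite -(ltr_pM2r (_ : 0 < (`|h| ^+ 2)^-1)) ?invr_gt0 //.
    have : d <= `|a - ('[a, h] / `|h| ^+ 2) *: h| ^+ 2.
      by apply: dS; eexists; last reflexivity; rewrite /= fB fZ fa fh mulr0 subr0.
    rewrite norm_sub_proj // lerBrDr => /le_lt_trans/(_ ade).
    by rewrite ltrD2l.
  exact: (norm_cvg_unique c1 c2).
have b0 : '[b, b] != 0.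
  apply: contra_eq_neq fb => /eqP; rewrite dotaa sqrf_eq0 normr_eq0 => /eqP ->.
  by rewrite f0 eq_sym oner_neq0.
(* The vector [a - f a *: b] lies in the kernel, hence is orthogonal to [b]; this determines the
   normalisation. *)
exists (('[b, b]^-1) *: b) => a.
have := ob (a - f a *: b); rewrite fB fZ fb mulr1 subrr => /(_ erefl).
rewrite dotBr dotZr => /subr0_eq h.
rewrite dotZr (dotC b a) h rmorphM /= conjCK fmorphV /= mulrCA mulVf ?mulr1 //.
by rewrite fmorph_eq0.
Qed.

End Riesz.

Section Adjoint.
Context {R : realType}.
Implicit Types H K L : hilbert R.

Lemma the_opP H K (P : set 'B(H, K)) x : P x -> P (the_op P).
Proof. exact: xgetI. Qed.

Lemma dot_op_bound H K (x : 'B(H, K)) :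
  exists2 c : R[i], 0 <= c & forall a b, `|'[x a, b]| <= c * `|a| * `|b|.
Proof.
have [c c0 xc] := op_bound x; exists c => // a b.
by apply: le_trans (dot_le _ _) _; rewrite ler_wpM2r.
Qed.

Lemma form_op H K (f : H -> K -> R[i]) (c : R[i]) : 0 <= c ->
  (forall k a a' b, f (k *: a + a') b = k * f a b + f a' b) ->
  (forall k a b b', f a (k *: b + b') = k^* * f a b + f a b') ->
  (forall a b, `|f a b| <= c * `|a| * `|b|) ->
  exists x : 'B(H, K), forall a b, '[x a, b] = f a b.
Proof.
move=> c0 fl fr fc.
have ex a : exists z, forall b, f a b = '[z, b].
  (* The form is antilinear in [b], so Riesz is applied to its conjugate. *)
  have [|k b b'|b|z hz] := @riesz _ K (fun b => (f a b)^*) (c * `|a|).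
  - by rewrite mulr_ge0.
  - by rewrite fr rmorphD rmorphM /= conjCK.
  - by rewrite norm_conjC.
  by exists z => b; rewrite dotC -hz conjCK.
have [g gE] := choice ex.
have [k a a'|a|x xE] := @bounded_linear_op _ H K g c c0.
- by apply: dot_inj => b; rewrite -gE fl dotDl dotZl !gE.
(* Testing the form at [b = g a] bounds [|g a|^2] by [c |a| |g a|]; one factor is then cancelled. *)
- have [->|ga] := eqVneq (g a) 0; first by rewrite normr0 mulr_ge0.
  have g0 : 0 < `|g a| by rewrite normr_gt0.
  rewrite -(ler_pM2r g0) -expr2 -dotaa -gE.
  by rewrite (le_trans (real_ler_norm _)) // gE dotaa realX ?normr_real.
by exists x => a b; rewrite xE gE.
Qed.

Lemma dot_adj H K (x : 'B(H, K)) a b : '[x a, b] = '[a, adj x b].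
Proof.
have [c c0 xc] := dot_op_bound x.
have [k b' b'' a'|k b' a' a''|b' a'|y yE] :=
  @form_op K H (fun b a => '[b, x a]) c c0.
- by rewrite dotDl dotZl.
- by rewrite linearP dotDr dotZr.
- by rewrite dotC norm_conjC -mulrA (mulrC `|b'|) mulrA.
apply: (@the_opP K H [set y | forall a b, '[x a, b] = '[a, y b]] y).
by move=> /= a' b'; rewrite (dotC (y b')) yE -dotC.
Qed.

Lemma dot_adjl H K (x : 'B(H, K)) a b : '[adj x b, a] = '[b, x a].
Proof. by rewrite dotC -dot_adj -dotC. Qed.

Lemma adj_unique H K (x : 'B(H, K)) (y : 'B(K, H)) :
  (forall a b, '[x a, b] = '[a, y b]) -> adj x = y.
Proof. by move=> xy; apply: op_ext => b; apply: dot_injr => a; rewrite -dot_adj xy. Qed.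

Lemma adjK H K (x : 'B(H, K)) : adj (adj x) = x.
Proof. by apply: adj_unique => b a; rewrite dot_adjl. Qed.

Lemma adj_comp H K L (y : 'B(K, L)) (x : 'B(H, K)) : adj (y ∘ x) = adj x ∘ adj y.
Proof. by apply: adj_unique => a b /=; rewrite !dot_adj. Qed.

Lemma adj1 H : adj (𝟙 : 'B(H)) = 𝟙.
Proof. exact: adj_unique. Qed.

Lemma adj0 H K : adj (0 : 'B(H, K)) = 0.
Proof. by apply: adj_unique => a b; rewrite !op0E dot0l dot0r. Qed.

Lemma adjD H K (x y : 'B(H, K)) : adj (x + y) = adj x + adj y.
Proof. by apply: adj_unique => a b; rewrite !opDE dotDl dotDr !dot_adj. Qed.

Lemma adj_sum H K (J : Type) (r : seq J) (P : pred J) (F : J -> 'B(H, K)) :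
  adj (\sum_(j <- r | P j) F j) = \sum_(j <- r | P j) adj (F j).
Proof. by apply: (big_morph (@adj R H K)) => [x y|]; rewrite ?adjD ?adj0. Qed.

Lemma comp_opE H K L (y : 'B(K, L)) (x : 'B(H, K)) a : (y ∘ x) a = y (x a).
Proof. by []. Qed.

Lemma compA H K L L' (z : 'B(L, L')) (y : 'B(K, L)) (x : 'B(H, K)) :
  z ∘ (y ∘ x) = z ∘ y ∘ x.
Proof. exact: op_ext. Qed.

Lemma comp1 H K (x : 'B(H, K)) : x ∘ 𝟙 = x. Proof. exact: op_ext. Qed.
Lemma comp1l H K (x : 'B(H, K)) : 𝟙 ∘ x = x. Proof. exact: op_ext. Qed.

Lemma compDl H K L (y y' : 'B(K, L)) (x : 'B(H, K)) : (y + y') ∘ x = y ∘ x + y' ∘ x.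
Proof. exact: op_ext. Qed.

Lemma comp_suml H K L (J : Type) (r : seq J) (P : pred J) (F : J -> 'B(K, L))
    (x : 'B(H, K)) :
  (\sum_(j <- r | P j) F j) ∘ x = \sum_(j <- r | P j) (F j ∘ x).
Proof. by apply: op_ext => a; rewrite comp_opE !op_sumE. Qed.

Lemma comp_sumr H K L (J : Type) (r : seq J) (P : pred J) (F : J -> 'B(H, K))
    (y : 'B(K, L)) :
  y ∘ (\sum_(j <- r | P j) F j) = \sum_(j <- r | P j) (y ∘ F j).
Proof. by apply: op_ext => a; rewrite comp_opE !op_sumE linear_sum. Qed.

Lemma comp0l H K L (x : 'B(H, K)) : (0 : 'B(K, L)) ∘ x = 0.
Proof. exact: op_ext. Qed.
Lemma comp0r H K L (y : 'B(K, L)) : y ∘ (0 : 'B(H, K)) = 0.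
Proof. by apply: op_ext => a; rewrite comp_opE !op0E linear0. Qed.
Lemma compZl H K L k (y : 'B(K, L)) (x : 'B(H, K)) : (k *: y) ∘ x = k *: (y ∘ x).
Proof. exact: op_ext. Qed.
Lemma rank_oneE H K (a : K) (b : H) c : rank_one a b c = '[c, b] *: a.
Proof.
have [|k d d'|d|x xE] := @bounded_linear_op _ H K (fun c => '[c, b] *: a) (`|a| * `|b|).
- by rewrite mulr_ge0.
- by rewrite dotDl dotZl scalerDl scalerA.
- by rewrite normrZ mulrC -mulrA ler_wpM2l // mulrC dot_le.
exact: (@the_opP H K [set x | forall c, x c = '[c, b] *: a] x).
Qed.

Lemma adj_rank_one H K (a : K) (b : H) : adj (rank_one a b) = rank_one b a.
Proof. by apply: adj_unique => c d; rewrite !rank_oneE dotZl dotZr -dotC mulrC. Qed.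

End Adjoint.

Section Density.
Context {R : realType}.
Implicit Types H K L : hilbert R.

Lemma closure_normP H (A : set H) a :
  closure A a <-> forall e : R[i], 0 < e -> exists2 b, A b & `|a - b| < e.
Proof.
split=> [Aa e e0|Aa B].
  have [|b [Ab]] := Aa (ball a e); first exact: nbhsx_ballx.
  by rewrite -ball_normE => abe; exists b.
move=> /nbhs_ballP[e /= e0 aB]; have [b Ab abe] := Aa e e0.
by exists b; split => //; apply: aB; rewrite -ball_normE.
Qed.

Lemma lspan_sub (V : lmodType R[i]) (A : set V) : A `<=` lspan A.
Proof.
by move=> a Aa; exists 1%N, (fun=> 1), (fun=> a); split => //; rewrite big_ord1 scale1r.
Qed.

Lemma lspan_ind (V : lmodType R[i]) (A P : set V) : P 0 ->
  (forall k v w, P v -> P w -> P (k *: v + w)) -> A `<=` P -> lspan A `<=` P.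
Proof.
move=> P0 PD AP _ [n [c [w [Aw ->]]]].
by elim/big_rec: _ => // i v _ Pv; apply: PD => //; exact: AP.
Qed.

Definition total_set H (A : set H) := closure (lspan A) = setT.

Lemma total_ind H (A P : set H) : total_set A -> P 0 ->
  (forall k v w, P v -> P w -> P (k *: v + w)) ->
  (forall v, (forall e : R[i], 0 < e -> exists2 w, P w & `|v - w| < e) -> P v) ->
  A `<=` P -> forall v, P v.
Proof.
move=> tA P0 PD Pcl AP v; apply: Pcl => e e0.
have : closure (lspan A) v by rewrite tA.
by move=> /closure_normP/(_ _ e0)[w /(lspan_ind P0 PD AP) Pw vw]; exists w.
Qed.

Lemma op_ext_total H K (A : set H) (x y : 'B(H, K)) : total_set A ->
  (forall a, A a -> x a = y a) -> x = y.
Proof.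
move=> tA xy; apply: op_ext; apply: (total_ind (P := fun v => x v = y v) tA) => //=.
- by rewrite !op0.
- by move=> k v w; rewrite !opD !opZ => -> ->.
move=> v hv; apply/subr0_eq/eqP; rewrite -normr_le0; apply/ler_addgt0Pr => e e0.
have [c c0 cP] := op_bound (x - y).
have [|w /= xyw vw] := hv (e / (c + 1)); first by rewrite divr_gt0 // ltr_wpDl ?ltr01.
rewrite add0r. rewrite -opBE -[v](subrK w) opD [(x - y) w]opBE xyw subrr addr0.
apply: (le_trans (cP _)).
rewrite (@le_trans _ _ ((c + 1) * `|v - w|)) ?ler_wpM2r ?lerDl ?ler01 //.
by rewrite mulrC -ler_pdivlMr ?ltr_wpDl ?ltr01 // ltW.
Qed.

(** The rank-one operator along [a - b] kills [A]. This transfers extensionality from operators to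
    vectors, and is used for triple tensors, where extensionality of operators comes first. *)
Lemma dot_separating H (A : set H) :
  (forall x : 'B(H), (forall c, A c -> x c = 0) -> x = 0) ->
  forall a b : H, (forall c, A c -> '[a, c] = '[b, c]) -> a = b.
Proof.
move=> sA a b ab; have : rank_one (a - b) (a - b) = 0 :> 'B(H).
  by apply: sA => c /ab abc; rewrite rank_oneE dotC dotBl abc subrr conjC0 scale0r.
move=> /(congr1 (fun x : 'B(H) => x (a - b))); rewrite rank_oneE op0E => /eqP.
rewrite scaler_eq0 dotaa sqrf_eq0 normr_eq0 orbb => /eqP; exact: subr0_eq.
Qed.

Lemma dot_total H (A : set H) (a b : H) : total_set A ->
  (forall c, A c -> '[a, c] = '[b, c]) -> a = b.
Proof.
move=> tA; apply: dot_separating => x x0; apply: (op_ext_total tA) => c Ac.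
by rewrite x0.
Qed.

(** The uniform bound [c] makes the set of vectors where convergence holds a closed subspace. In the
    closing estimate, [c + d + 1] dominates the bounds of [u t] and [x] together and is positive. *)
Lemma cvg_total H K (T : Type) (F : set_system T) {FF : Filter F} (A : set H)
    (u : T -> 'B(H, K)) (x : 'B(H, K)) (c : R[i]) : total_set A -> 0 <= c ->
  (forall t v, `|u t v| <= c * `|v|) ->
  (forall a, A a -> u t a @[t --> F] --> x a) -> strong_cvg F u x.
Proof.
move=> tA c0 uc uA.
apply: (total_ind (P := fun v => u t v @[t --> F] --> x v) tA) => //=.
- under eq_cvg do rewrite op0; rewrite op0; exact: cvg_cst.
- move=> k v w uv uw; under eq_cvg do rewrite opD opZ; rewrite opD opZ.
  by apply: cvgD => //; exact: cvgZr.
move=> v hv; apply/cvgrPdist_lt => e e0.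
have [d d0 xd] := op_bound x.
have cd : 0 < c + d + 1 by rewrite ltr_wpDl ?addr_ge0 ?ltr01.
have [|w /= uw vw] := hv (e / 2 / (c + d + 1)); first by rewrite !divr_gt0.
have /cvgrPdist_lt/(_ (e / 2)) := uw; rewrite divr_gt0 // => /(_ isT) near_w.
near=> t; have -> : x v - u t v = (x w - u t w) + (x (v - w) - u t (v - w)).
  by rewrite !opB opprB addrACA [x w + _]addrC subrK addKr.
apply: le_lt_trans (ler_normD _ _) _; rewrite [e]splitr.
apply: ltr_leD; first by near: t.
apply: le_trans (ler_normB _ _) _.
apply: le_trans (lerD (xd _) (uc _ _)) _.
rewrite -mulrDl (@le_trans _ _ ((c + d + 1) * `|v - w|)) //.
  by rewrite ler_wpM2r // addrC lerDl ler01.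
by rewrite mulrC -ler_pdivlMr // ltW.
Unshelve. all: by end_near. Qed.

End Density.

Section Extension.
Context {R : realType} {H K : hilbert R} {T : Type}.
Variables (g : T -> H) (h : T -> K) (C : R[i]).
Hypothesis C0 : 0 <= C.
Hypothesis g_total : total_set (range g).

(** Formal combinations: one list is evaluated both through [g] and through [h], so the extension
    can be discussed before it is known to be well defined on the span. *)
Definition lincomb (L : hilbert R) (f : T -> L) (s : seq (R[i] * T)) : L :=
  \sum_(p <- s) p.1 *: f p.2.

Hypothesis gh : forall s, `|lincomb h s| <= C * `|lincomb g s|.

Lemma lincombP (L : hilbert R) (f : T -> L) k s s' :
  lincomb f ([seq (k * p.1, p.2) | p <- s] ++ s') = k *: lincomb f s + lincomb f s'.
Proof.
rewrite /lincomb big_cat big_map /= scaler_sumr; congr (_ + _).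
by apply: eq_bigr => p _; rewrite scalerA.
Qed.

(** The closure of the graph of the extension, as a relation; [rel_bound] together with [rel_lin]
    makes it single-valued. *)
Let rel_at (X : H) (Z : K) := forall e : R[i], 0 < e ->
  exists s, `|X - lincomb g s| < e /\ `|Z - lincomb h s| < e.

Let rel_ex X : exists Z, rel_at X Z.
Proof.
pose B (e : R[i]) := [set s | `|X - lincomb g s| < e].
have FB : ProperFilter (filter_from [set e : R[i] | 0 < e] B).
  apply: filter_from_pos => [e1 e2 e12 s /= /lt_le_trans|e e0]; first exact.
  have : closure (lspan (range g)) X by rewrite g_total.
  move=> /closure_normP/(_ _ e0)[w gw Xw].
  suff [s ws] : exists s, w = lincomb g s by exists s; rewrite /B /= -ws.
  apply: (lspan_ind (P := fun w => exists s, w = lincomb g s)) gw => /=.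
  - by exists nil; rewrite /lincomb big_nil.
  - by move=> k _ _ [s ->] [s' ->]; eexists; rewrite -lincombP.
  - by move=> _ [t _ <-]; exists [:: (1, t)]; rewrite /lincomb big_seq1 scale1r.
set F := filter_from _ _ in FB.
have : cvg (lincomb h s @[s --> F]).
  apply: hilbert_cauchy_cvg => e e0.
  have d0 : 0 < e / (C + 1) / 2 by rewrite !divr_gt0 // ltr_wpDl ?ltr01.
  have [s sB] : B (e / (C + 1) / 2) !=set0.
    by have := @filter_ex _ F _ (B (e / (C + 1) / 2)); apply; exists (e / (C + 1) / 2).
  exists (lincomb h s), (e / (C + 1) / 2) => // t tB /=.
  have := gh ([seq (- 1 * p.1, p.2) | p <- t] ++ s).
  rewrite !lincombP !scaleN1r addrC => /le_lt_trans; apply.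
  apply: (@le_lt_trans _ _ ((C + 1) * `|lincomb g s - lincomb g t|)).
    by rewrite addrC ler_wpM2r // lerDl ler01.
  rewrite mulrC -ltr_pdivlMr ?ltr_wpDl ?ltr01 // [X in _ < X]splitr.
  have -> : lincomb g s - lincomb g t = (X - lincomb g t) - (X - lincomb g s).
    by rewrite opprB [RHS]addrC subrKA.
  by rewrite (le_lt_trans (ler_normB _ _)) // ltrD.
move=> /cvg_ex[Z /cvgrPdist_lt ZF]; exists Z => e e0.
have := @filter_ex _ F _ (fun s => `|X - lincomb g s| < e /\ `|Z - lincomb h s| < e).
by apply; apply: filterI; [exists e | exact: ZF].
Qed.

Let rel_lin k X Z X' Z' :
  rel_at X Z -> rel_at X' Z' -> rel_at (k *: X + X') (k *: Z + Z').
Proof.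
move=> XZ XZ' e e0.
have k0 : 0 < `|k| + 1 by rewrite ltr_wpDl ?ltr01.
have e2 : 0 < e / 2 by rewrite divr_gt0 // ltr0n.
have [s [Xs Zs]] := XZ _ (divr_gt0 e2 k0).
have [s' [Xs' Zs']] := XZ' _ e2.
have main (L : hilbert R) (f : T -> L) Y Y' :
    `|Y - lincomb f s| < e / 2 / (`|k| + 1) -> `|Y' - lincomb f s'| < e / 2 ->
    `|k *: Y + Y' - lincomb f ([seq (k * p.1, p.2) | p <- s] ++ s')| < e.
  move=> Ys Ys'; rewrite lincombP opprD addrACA -scalerBr.
  rewrite (le_lt_trans (ler_normD _ _)) // [e]splitr ler_ltD // normrZ.
  apply: (@le_trans _ _ ((`|k| + 1) * `|Y - lincomb f s|)).
    by rewrite ler_wpM2r // lerDl ler01.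
  by rewrite mulrC -ler_pdivlMr // ltW.
by exists ([seq (k * p.1, p.2) | p <- s] ++ s'); split; apply: main.
Qed.

Let rel_bound X Z : rel_at X Z -> `|Z| <= C * `|X|.
Proof.
move=> XZ; apply/ler_addgt0Pr => e e0.
have C1 : 0 < C + 1 by rewrite ltr_wpDl ?ltr01.
have [s [Xs Zs]] := XZ (e / (C + 1)) (divr_gt0 e0 C1).
rewrite -[Z](subrK (lincomb h s)) addrC (le_trans (ler_normD _ _)) //.
have -> : C * `|X| + e = C * (`|X| + e / (C + 1)) + e / (C + 1).
  by field; rewrite gt_eqF.
rewrite lerD ?(ltW Zs) // (le_trans (gh _)) // ler_wpM2l //.
rewrite -[in X in X <= _](subrK X (lincomb g s)) addrC (le_trans (ler_normD _ _)) //.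
by rewrite lerD2l distrC ltW.
Qed.

Lemma extend_total : exists z : 'B(H, K), forall t, z (g t) = h t.
Proof.
have [f fP] := choice rel_ex.
(* The difference of the two values is related to [X - X = 0], so its norm is at most [C * 0]. *)
have uniq X Z Z' : rel_at X Z -> rel_at X Z' -> Z = Z'.
  move=> XZ XZ'; have := rel_bound (rel_lin (- 1) XZ XZ').
  rewrite !scaleN1r addNr normr0 mulr0 normr_le0 addrC => /eqP/subr0_eq ->//.
have [k a b|a|z zf] := @bounded_linear_op _ H K f C C0.
- by apply: uniq (fP _) (rel_lin _ (fP _) (fP _)).
- exact/rel_bound/fP.
exists z => t; rewrite zf; apply: uniq (fP _) _ => e e0.
by exists [:: (1, t)]; rewrite /lincomb !big_seq1 /= !scale1r !subrr !normr0; split.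
Qed.

End Extension.

Section Projections.
Context {R : realType} {H : hilbert R}.

Definition projection (p : 'B(H)) := adj p = p /\ p ∘ p = p.

Lemma dot_projection (p : 'B(H)) a b : projection p -> '[p a, p b] = '[p a, b].
Proof. by move=> [pa pp]; rewrite -dot_adjl pa -comp_opE pp. Qed.

Lemma projection_norm (p : 'B(H)) a : projection p -> `|p a| <= `|a|.
Proof.
move=> pP; have h : '[p a, a - p a] = 0 by rewrite dotBr dot_projection // subrr.
rewrite -(@ler_pXn2r _ 2) ?nnegrE //.
by rewrite -[in leRHS](subrK (p a) a) [in leRHS]addrC (norm_orthoD h) lerDl exprn_ge0.
Qed.

(** The defects [|v|^2 - |p t v|^2] have an infimum; once some [t0] is close to it, every later
    [p t v] is close to [p t0 v], because their difference is orthogonal to [p t0 v]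
    (Pythagoras). *)
Lemma increasing_projections_cvg (T : Type) (F : set_system T) {FF : ProperFilter F}
    (p : T -> 'B(H)) : (forall t, projection (p t)) ->
  (forall t0, \forall t \near F, p t ∘ p t0 = p t0) ->
  exists q : 'B(H), strong_cvg F p q.
Proof.
move=> pP pmono.
have pcvg v : cvg (p t v @[t --> F]).
  have [||d [d0 dS Sd]] := @nonneg_inf R [set `|v| ^+ 2 - `|p t v| ^+ 2 | t in setT].
  - by have [t _] := filter_ex (@filterT _ F _); eexists; exists t.
  - by move=> _ [t _ <-]; rewrite subr_ge0 lerXn2r ?nnegrE // projection_norm.
  apply: hilbert_cauchy_cvg => e e0.
  have [_ [t0 _ <-] ht0] := Sd (e ^+ 2) (exprn_gt0 _ e0).
  exists (p t0 v); near=> t.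
  have pt : p t (p t0 v) = p t0 v.
    by rewrite -comp_opE; congr (bounded_op_fun _ v); near: t; exact: pmono.
  have dt : d <= `|v| ^+ 2 - `|p t v| ^+ 2 by apply: dS; exists t.
  rewrite -(@ltr_pXn2r _ 2) ?nnegrE ?(ltW e0) // distrC.
  have E : '[p t0 v, p t v - p t0 v] = 0.
    by rewrite dotBr -{1}pt dot_projection // pt dot_projection // subrr.
  have := norm_orthoD E; rewrite addrC subrK => E2.
  move: dt; rewrite E2 opprD addrA lerBrDr => /le_lt_trans/(_ ht0).
  by rewrite ltrD2l.
have [q0 q0P] := choice (fun v => (cvg_ex _).1 (pcvg v)).
have [k a b|a|q qq0] := @bounded_linear_op _ H H q0 1 ler01.
- have c1 : p t (k *: a + b) @[t --> F] --> k *: q0 a + q0 b.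
    under eq_cvg do rewrite opD opZ; apply: cvgD (q0P b).
    exact: cvgZr (q0P a).
  exact: norm_cvg_unique (q0P _) c1.
- have := cvg_norm (q0P a); rewrite mul1r => c1.
  apply/ler_addgt0Pr => e e0.
  have /cvgrPdist_lt/(_ _ e0) near_e := q0P a.
  have [t qt] := filter_ex near_e.
  rewrite -[q0 a](subrK (p t a)) (le_trans (ler_normD _ _)) // addrC.
  by rewrite lerD ?(ltW qt) // projection_norm.
by exists q => v; rewrite qq0; exact: q0P.
Unshelve. all: by end_near. Qed.

End Projections.

(** * Tensor products *)

Section PureTensors.
Context {R : realType} {tp : tensor_products R} {H K : hilbert R}.
Implicit Types (a : H) (b : K).

Lemma tensDl a a' b : (a + a') ⊗ᵥ b = a ⊗ᵥ b + a' ⊗ᵥ b.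
Proof. exact: linearDl. Qed.
Lemma tensDr a b b' : a ⊗ᵥ (b + b') = a ⊗ᵥ b + a ⊗ᵥ b'.
Proof. exact: linearDr. Qed.
Lemma tensBr a b b' : a ⊗ᵥ (b - b') = a ⊗ᵥ b - a ⊗ᵥ b'.
Proof. exact: linearBr. Qed.
Lemma tensZl k a b : (k *: a) ⊗ᵥ b = k *: (a ⊗ᵥ b).
Proof. exact: linearZl_LR. Qed.
Lemma tensZr k a b : a ⊗ᵥ (k *: b) = k *: (a ⊗ᵥ b).
Proof. exact: linearZr_LR. Qed.
Lemma tens_suml (J : Type) (r : seq J) (P : pred J) (F : J -> H) b :
  (\sum_(j <- r | P j) F j) ⊗ᵥ b = \sum_(j <- r | P j) F j ⊗ᵥ b.
Proof. exact: linear_sumlz. Qed.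
Lemma tens_sumr (J : Type) (r : seq J) (P : pred J) (F : J -> K) a :
  a ⊗ᵥ (\sum_(j <- r | P j) F j) = \sum_(j <- r | P j) a ⊗ᵥ F j.
Proof. exact: linear_sumr. Qed.

Lemma dot_tens a b a' b' : '[a ⊗ᵥ b, a' ⊗ᵥ b'] = '[a, a'] * '[b, b'].
Proof. exact: tensor_dot. Qed.

Lemma norm_tens a b : `|a ⊗ᵥ b| = `|a| * `|b|.
Proof.
apply/eqP; rewrite -(@eqrXn2 _ 2) ?mulr_ge0 //.
by rewrite exprMn -!dotaa dot_tens.
Qed.

Lemma total_pure :
  total_set [set v : H ⊗ K | exists p : H * K, v = p.1 ⊗ᵥ p.2].
Proof.
rewrite /total_set -(tensor_total (tensor_of H K)); congr (closure (lspan _)).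
apply/seteqP; split=> [_ [[a b] ->]|_ [a _] [b _] <-]; first by exists a => //; exists b.
by exists (a, b).
Qed.

Lemma total_range_pure : total_set (range (fun p : H * K => p.1 ⊗ᵥ p.2)).
Proof.
rewrite /total_set -total_pure; congr (closure (lspan _)).
by apply/seteqP; split=> [_ [p _ <-]|_ [p ->]]; exists p.
Qed.

Lemma op_ext_pure (L : hilbert R) (x y : 'B(H ⊗ K, L)) :
  (forall a b, x (a ⊗ᵥ b) = y (a ⊗ᵥ b)) -> x = y.
Proof. by move=> xy; apply: (op_ext_total total_pure) => _ [[a b] ->]. Qed.

Lemma dot_pure (X Y : H ⊗ K) : (forall a b, '[X, a ⊗ᵥ b] = '[Y, a ⊗ᵥ b]) -> X = Y.
Proof. by move=> XY; apply: (dot_total total_pure) => _ [[a b] ->]. Qed.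

(** The adjoints of [ketl] and [ketr] contract one leg, so that slices become compositions of
    operators ([slice_r_vecE], [slice_l_vecE]). *)
Definition ketl a : 'B(K, H ⊗ K) := the_op [set z | forall b, z b = a ⊗ᵥ b].
Definition ketr b : 'B(H, H ⊗ K) := the_op [set z | forall a, z a = a ⊗ᵥ b].

Lemma ketlE a b : ketl a b = a ⊗ᵥ b.
Proof.
have [k b1 b2|b'|x xE] := @bounded_linear_op _ K (H ⊗ K) (fun b => a ⊗ᵥ b) `|a| (normr_ge0 a).
- by rewrite tensDr tensZr.
- by rewrite norm_tens.
exact: (@the_opP _ _ _ [set z | forall b, z b = a ⊗ᵥ b] x).
Qed.

Lemma ketrE b a : ketr b a = a ⊗ᵥ b.
Proof.
have [k a1 a2|a'|x xE] := @bounded_linear_op _ H (H ⊗ K) (fun a => a ⊗ᵥ b) `|b| (normr_ge0 b).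
- by rewrite tensDl tensZl.
- by rewrite norm_tens mulrC.
exact: (@the_opP _ _ _ [set z | forall a, z a = a ⊗ᵥ b] x).
Qed.

Lemma adj_ketrE b a' b' : adj (ketr b) (a' ⊗ᵥ b') = '[b', b] *: a'.
Proof.
by apply: dot_inj => c; rewrite dot_adjl ketrE dot_tens dotZl mulrC.
Qed.

Lemma adj_ketlE a a' b' : adj (ketl a) (a' ⊗ᵥ b') = '[a', a] *: b'.
Proof. by apply: dot_inj => c; rewrite dot_adjl ketlE dot_tens dotZl. Qed.

End PureTensors.

Section IsometricExtension.
Context {R : realType} {H K : hilbert R} {T : Type}.

(** Equal Gram matrices give equal norms of all combinations, so [extend_total] applies with
    constant 1. *)
Lemma extend_isometry (g : T -> H) (h : T -> K) : total_set (range g) ->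
  (forall s t, '[h s, h t] = '[g s, g t]) ->
  exists z : 'B(H, K), forall t, z (g t) = h t.
Proof.
move=> tg gh; apply: (@extend_total _ _ _ _ g h 1 ler01 tg) => s.
rewrite mul1r -(@ler_pXn2r _ 2) ?nnegrE // -!dotaa /lincomb !dot_suml.
rewrite le_eqVlt; apply/orP; left; apply/eqP; apply: eq_bigr => p _.
rewrite !dotZl !dot_sumr; congr (_ * _); apply: eq_bigr => q _.
by rewrite !dotZr gh.
Qed.

End IsometricExtension.

Section GramSchmidt.
Context {R : realType} {tp : tensor_products R} {H K : hilbert R}.

Let tsum (L : hilbert R) (f : H -> L) (s : seq (H * K)) : L ⊗ K :=
  \sum_(q <- s) f q.1 ⊗ᵥ q.2.

Let ortho_to (d : K) := [pred q : H * K | '[q.2, d] == 0].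

(** Gram-Schmidt on the second legs, the corrections being collected in the first leg. Only
    linearity of [f] is used, so one list serves all [f]. The third clause carries the orthogonality
    to earlier vectors through the induction. *)
Lemma orthogonalize (s : seq (H * K)) : exists s' : seq (H * K),
  [/\ forall (L : hilbert R) (f : 'B(H, L)), tsum f s = tsum f s',
      pairwise (fun p q : H * K => '[q.2, p.2] == 0) s' &
      forall d, all (ortho_to d) s -> all (ortho_to d) s'].
Proof.
have [n] := ubnP (size s); elim: n s => // n IH [|[a b] t] /= tn.
  by exists nil; split.
(* For [b = 0] the quotient is 0 by convention, and orthogonality to [b] is trivial. *)
pose c (q : H * K) := '[q.2, b] / '[b, b].
have [|t' [sumt' ot' dt']] := IH [seq (q.1, q.2 - c q *: b) | q <- t].
  by rewrite size_map.
exists ((a + \sum_(q <- t) c q *: q.1, b) :: t'); split => /=.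
- move=> L f; rewrite /tsum !big_cons /= -/(tsum f t') -sumt' /tsum big_map /=.
  rewrite opD tensDl -addrA; congr (_ + _).
  rewrite op_sum tens_suml -big_split /=; apply: eq_bigr => q _.
  by rewrite opZ tensZl tensBr tensZr addrC subrK.
- rewrite ot' andbT; apply: dt'; rewrite all_map; apply/allP => q _ /=.
  rewrite dotBl dotZl /c; have [->|b0] := eqVneq b 0; first by rewrite !dot0r mulr0 subrr.
  by rewrite divfK ?subrr // dotaa expf_eq0 normr_eq0.
- move=> d /andP[bd td]; rewrite bd dt' // all_map; apply/allP => q /(allP td) /=.
  by move/eqP: bd => /= bd /eqP qd; rewrite dotBl dotZl qd bd mulr0 subrr.
Qed.

(** After orthogonalizing, both squared norms are sums over the terms by Pythagoras and compare
    termwise. This is the boundedness of [f ⊗ 1] on the algebraic tensor product. *)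
Lemma tsum_bound (L : hilbert R) (f : 'B(H, L)) (c : R[i]) s : 0 <= c ->
  (forall a, `|f a| <= c * `|a|) -> `|tsum f s| <= c * `|tsum (𝟙 : 'B(H)) s|.
Proof.
move=> c0 fc; have [s' [E os' _]] := orthogonalize s; rewrite !E {s E}.
have norm_tsum (L' : hilbert R) (f' : 'B(H, L')) :
    `|tsum f' s'| ^+ 2 = \sum_(q <- s') `|f' q.1| ^+ 2 * `|q.2| ^+ 2.
  elim: s' os' => [_|p s' IH] /=; first by rewrite /tsum !big_nil normr0 expr0n.
  move=> /andP[ps' os']; rewrite /tsum !big_cons -/(tsum f' s') norm_orthoD ?IH //.
    by rewrite norm_tens exprMn.
  rewrite dot_sumr big_seq big1 // => q /(allP ps') /eqP qp.
  by rewrite dot_tens (dotC q.2) qp conjC0 mulr0.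
rewrite -(@ler_pXn2r _ 2) ?nnegrE ?mulr_ge0 // exprMn !norm_tsum mulr_sumr.
apply: ler_sum => q _; rewrite [leRHS]mulrA; apply: ler_wpM2r; first exact: exprn_ge0.
by rewrite -exprMn lerXn2r ?nnegrE ?mulr_ge0.
Qed.

End GramSchmidt.

Section TensorOp.
Context {R : realType} {tp : tensor_products R}.
Implicit Types H K L : hilbert R.

Lemma ampliation H H' K (x : 'B(H, H')) :
  exists z : 'B(H ⊗ K, H' ⊗ K), forall a b, z (a ⊗ᵥ b) = x a ⊗ᵥ b.
Proof.
have [c c0 xc] := op_bound x.
have [s|z zE] := @extend_total _ _ _ (H * K) (fun p => p.1 ⊗ᵥ p.2)
    (fun p => x p.1 ⊗ᵥ p.2) c c0 total_range_pure.
  have lincombE L (f : 'B(H, L)) : lincomb (fun p : H * K => f p.1 ⊗ᵥ p.2) s =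
      \sum_(q <- [seq (p.1 *: p.2.1, p.2.2) | p <- s]) f q.1 ⊗ᵥ q.2.
    rewrite /lincomb big_map; apply: eq_bigr => p _ /=.
    by rewrite opZ tensZl.
  by rewrite lincombE (lincombE _ 𝟙); exact: tsum_bound.
by exists z => a b; exact: (zE (a, b)).
Qed.

Lemma flipE H K (a : H) (b : K) : flip H K (a ⊗ᵥ b) = b ⊗ᵥ a.
Proof.
have [p q|z zE] := @extend_isometry _ _ _ (H * K) (fun p => p.1 ⊗ᵥ p.2)
    (fun p => p.2 ⊗ᵥ p.1) total_range_pure.
  by rewrite !dot_tens mulrC.
apply: (@the_opP _ _ _ [set z : 'B(H ⊗ K, K ⊗ H) | forall a b, z (a ⊗ᵥ b) = b ⊗ᵥ a] z).
by move=> a' b'; exact: (zE (a', b')).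
Qed.

(** Only [x ⊗ 1] has been constructed; conjugating [y ⊗ 1] by flips supplies the factor on the other
    leg. *)
Lemma tensor_opE H H' K K' (x : 'B(H, H')) (y : 'B(K, K')) a b :
  (x ⊗ₒ y) (a ⊗ᵥ b) = x a ⊗ᵥ y b.
Proof.
have [x1 x1E] := @ampliation H H' K' x.
have [y1 y1E] := @ampliation K K' H y.
apply: (@the_opP _ _ _ [set z : 'B(H ⊗ K, H' ⊗ K') | forall a b, z (a ⊗ᵥ b) = x a ⊗ᵥ y b]
  (x1 ∘ flip K' H ∘ y1 ∘ flip H K)).
by move=> a' b'; rewrite !comp_opE flipE y1E flipE x1E.
Qed.

Lemma tensor_op_comp H H' H'' K K' K'' (x' : 'B(H', H'')) (x : 'B(H, H'))
    (y' : 'B(K', K'')) (y : 'B(K, K')) :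
  (x' ∘ x) ⊗ₒ (y' ∘ y) = (x' ⊗ₒ y') ∘ (x ⊗ₒ y).
Proof. by apply: op_ext_pure => a b; rewrite comp_opE !tensor_opE. Qed.

Lemma adj_tensor_op H H' K K' (x : 'B(H, H')) (y : 'B(K, K')) :
  adj (x ⊗ₒ y) = adj x ⊗ₒ adj y.
Proof.
apply: op_ext_pure => a b; apply: dot_pure => c d.
by rewrite dot_adjl !tensor_opE !dot_tens !dot_adjl.
Qed.

Lemma tensor_op1 H K : (𝟙 : 'B(H)) ⊗ₒ (𝟙 : 'B(K)) = 𝟙.
Proof. by apply: op_ext_pure => a b; rewrite tensor_opE. Qed.

Lemma tensor_op_sumr H H' K K' (x : 'B(H, H')) (J : Type) (r : seq J) (P : pred J)
    (F : J -> 'B(K, K')) :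
  x ⊗ₒ (\sum_(j <- r | P j) F j) = \sum_(j <- r | P j) x ⊗ₒ F j.
Proof.
apply: op_ext_pure => a b; rewrite tensor_opE !op_sumE tens_sumr.
by apply: eq_bigr => j _; rewrite tensor_opE.
Qed.

Lemma tensor_projection H K (p : 'B(H)) (q : 'B(K)) :
  projection p -> projection q -> projection (p ⊗ₒ q).
Proof.
move=> [pa pp] [qa qq]; split; first by rewrite adj_tensor_op pa qa.
by rewrite -tensor_op_comp pp qq.
Qed.

Lemma projection1 H : projection (𝟙 : 'B(H)).
Proof. by split; [exact: adj1 | exact: comp1]. Qed.

(** Projections provide the uniform bound 1 that reduces convergence to elementary tensors. *)
Lemma tensor_strong_cvgr H K (T : Type) (F : set_system T) {FF : Filter F}
    (p : T -> 'B(K)) (q : 'B(K)) : (forall t, projection (p t)) ->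
  strong_cvg F p q ->
  strong_cvg F (fun t => (𝟙 : 'B(H)) ⊗ₒ p t) (𝟙 ⊗ₒ q).
Proof.
move=> pP pq; apply: (cvg_total total_pure ler01) => [t v|_ [[a b] ->]].
  by rewrite mul1r projection_norm //; apply: tensor_projection => //; exact: projection1.
under eq_cvg do rewrite tensor_opE -ketlE.
by rewrite tensor_opE -ketlE; apply: op_cvg; exact: pq.
Qed.

Lemma tensor_strong_cvgl H K (T : Type) (F : set_system T) {FF : Filter F}
    (p : T -> 'B(H)) (q : 'B(H)) : (forall t, projection (p t)) ->
  strong_cvg F p q ->
  strong_cvg F (fun t => p t ⊗ₒ (𝟙 : 'B(K))) (q ⊗ₒ 𝟙).
Proof.
move=> pP pq; apply: (cvg_total total_pure ler01) => [t v|_ [[a b] ->]].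
  by rewrite mul1r projection_norm //; apply: tensor_projection => //; exact: projection1.
under eq_cvg do rewrite tensor_opE -ketrE.
by rewrite tensor_opE -ketrE; apply: op_cvg; exact: pq.
Qed.

(** The prescribed value is first extended to [X ⊗ c] with [X] arbitrary in [H ⊗ K], as
    [(1 ⊗ ketr c) X]; isometric extension then applies because [ketr c1] and [ketr c2] compose to
    the scalar ['[c2, c1]]. *)
Lemma assocE H K L (a : H) (b : K) (c : L) :
  assoc H K L ((a ⊗ᵥ b) ⊗ᵥ c) = a ⊗ᵥ (b ⊗ᵥ c).
Proof.
have [h hE] : exists h : (H ⊗ K) * L -> H ⊗ (K ⊗ L),
    forall p, h p = ((𝟙 : 'B(H)) ⊗ₒ ketr p.2) p.1 by exists (fun p => (𝟙 ⊗ₒ ketr p.2) p.1).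
have [[X c1] [Y c2]|z zE] := @extend_isometry _ _ _ ((H ⊗ K) * L)
    (fun p => p.1 ⊗ᵥ p.2) h total_range_pure.
  have E : adj (𝟙 ⊗ₒ ketr c1) ∘ (𝟙 ⊗ₒ ketr c2) = '[c2, c1] *: (𝟙 : 'B(H ⊗ K)).
    rewrite adj_tensor_op -tensor_op_comp adj1 comp1; apply: op_ext_pure => a' b'.
    by rewrite tensor_opE comp_opE ketrE adj_ketrE opZE tensZr.
  by rewrite !hE /= dot_tens dot_adj -comp_opE E opZE dotZr -dotC mulrC.
apply: (@the_opP _ _ _ [set z : 'B((H ⊗ K) ⊗ L, H ⊗ (K ⊗ L)) |
  forall a b c, z ((a ⊗ᵥ b) ⊗ᵥ c) = a ⊗ᵥ (b ⊗ᵥ c)] z).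
by move=> a' b' c'; rewrite (zE (a' ⊗ᵥ b', c')) hE tensor_opE ketrE.
Qed.

Lemma op_ext_pure3 H K L L' (x y : 'B((H ⊗ K) ⊗ L, L')) :
  (forall a b c, x ((a ⊗ᵥ b) ⊗ᵥ c) = y ((a ⊗ᵥ b) ⊗ᵥ c)) -> x = y.
Proof.
move=> xy; apply: op_ext_pure => X c; rewrite -!ketrE -!comp_opE.
by congr (bounded_op_fun _ X); apply: op_ext_pure => a b; rewrite !comp_opE ketrE.
Qed.

Lemma dot_pure3 H K L (X Y : (H ⊗ K) ⊗ L) :
  (forall a b c, '[X, (a ⊗ᵥ b) ⊗ᵥ c] = '[Y, (a ⊗ᵥ b) ⊗ᵥ c]) -> X = Y.
Proof.
move=> XY; apply: (@dot_separating R _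
  [set v : (H ⊗ K) ⊗ L | exists a b c, v = (a ⊗ᵥ b) ⊗ᵥ c]) => [x x0|].
  by apply: op_ext_pure3 => a b c; rewrite x0 //; exists a, b, c.
by move=> _ [a [b [c ->]]]; exact: XY.
Qed.

Lemma adj_assocE H K L (a : H) (b : K) (c : L) :
  adj (assoc H K L) (a ⊗ᵥ (b ⊗ᵥ c)) = (a ⊗ᵥ b) ⊗ᵥ c.
Proof.
by apply: dot_pure3 => a' b' c'; rewrite dot_adjl assocE !dot_tens mulrA.
Qed.

Lemma slice_r_vecE H K H' K' (c : K) (d : K') (X : 'B(H ⊗ K, H' ⊗ K')) :
  slice_r_vec c d X = adj (ketr d) ∘ X ∘ ketr c.
Proof.
set z := adj _ ∘ _ ∘ _.
have zP : forall a b, '[z a, b] = '[X (a ⊗ᵥ c), b ⊗ᵥ d].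
  by move=> a b; rewrite /z !comp_opE dot_adjl !ketrE.
have := @the_opP _ _ _ [set z : 'B(H, H') | forall a b, '[z a, b] = '[X (a ⊗ᵥ c), b ⊗ᵥ d]]
  z zP.
by move=> h; apply: op_ext => a; apply: dot_inj => b; rewrite zP -h.
Qed.

Lemma slice_l_vecE H K H' K' (a : H) (b : H') (X : 'B(H ⊗ K, H' ⊗ K')) :
  slice_l_vec a b X = adj (ketl b) ∘ X ∘ ketl a.
Proof.
set z := adj _ ∘ _ ∘ _.
have zP : forall c d, '[z c, d] = '[X (a ⊗ᵥ c), b ⊗ᵥ d].
  by move=> c d; rewrite /z !comp_opE dot_adjl !ketlE.
have := @the_opP _ _ _ [set z : 'B(K, K') | forall c d, '[z c, d] = '[X (a ⊗ᵥ c), b ⊗ᵥ d]]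
  z zP.
by move=> h; apply: op_ext => c; apply: dot_inj => d; rewrite zP -h.
Qed.

Lemma dot_slice_r_vec H K H' K' (c : K) (d : K') (X : 'B(H ⊗ K, H' ⊗ K')) a b :
  '[slice_r_vec c d X a, b] = '[X (a ⊗ᵥ c), b ⊗ᵥ d].
Proof. by rewrite slice_r_vecE !comp_opE dot_adjl !ketrE. Qed.

Lemma dot_slice_l_vec H K H' K' (a : H) (b : H') (X : 'B(H ⊗ K, H' ⊗ K')) c d :
  '[slice_l_vec a b X c, d] = '[X (a ⊗ᵥ c), b ⊗ᵥ d].
Proof. by rewrite slice_l_vecE !comp_opE dot_adjl !ketlE. Qed.

Lemma adj_slice_r_vec H K H' K' (c : K) (d : K') (X : 'B(H ⊗ K, H' ⊗ K')) :
  adj (slice_r_vec c d X) = slice_r_vec d c (adj X).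
Proof. by rewrite !slice_r_vecE !adj_comp adjK compA. Qed.

Lemma adj_slice_l_vec H K H' K' (a : H) (b : H') (X : 'B(H ⊗ K, H' ⊗ K')) :
  adj (slice_l_vec a b X) = slice_l_vec b a (adj X).
Proof. by rewrite !slice_l_vecE !adj_comp adjK compA. Qed.

(* [slice_r w X] is the junk value 0 unless the form [w (slice_l_vec a b X)] is
   bounded, which is clear when [w] is a vector functional on the slices. *)
Lemma slice_r_vector H K H' K' (c : K) (d : K') (w : 'B(K, K') -> R[i])
    (X : 'B(H ⊗ K, H' ⊗ K')) :
  (forall a b, w (slice_l_vec a b X) = '[slice_l_vec a b X c, d]) ->
  slice_r w X = slice_r_vec c d X.
Proof.
move=> wcd; have h : forall a b, '[slice_r_vec c d X a, b] = w (slice_l_vec a b X).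
  by move=> a b; rewrite wcd dot_slice_l_vec dot_slice_r_vec.
have := @the_opP _ _ _ [set z : 'B(H, H') | forall a b, '[z a, b] = w (slice_l_vec a b X)] _ h.
by move=> h'; apply: op_ext => a; apply: dot_inj => b; rewrite h -h'.
Qed.

End TensorOp.

(** * The sigma-weak topology *)

Section SigmaWeak.
Context {R : realType}.
Implicit Types H K L : hilbert R.

Lemma cvg_initial (S : choiceType) (T : topologicalType) (f : S -> T) (U : Type)
    (F : set_system U) {FF : Filter F} (u : U -> S) (x : S) :
  f (u t) @[t --> F] --> f x -> u t @[t --> F] --> (x : initial_topology f).
Proof.
move=> fu A; rewrite (@nbhsE (initial_topology f)) => -[B [[C oC <-] Cx] BA].
apply: (@filterS _ F _ (fun t => C (f (u t)))) => [t Ct|]; first exact: BA.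
by apply: fu; apply: open_nbhs_nbhs.
Qed.

Lemma normal_functional_continuous H K (w : 'B(H, K) -> R[i]) :
  normal_functional w -> continuous (w : 'B(H, K) -> R[i]^o).
Proof.
move=> hw x; pose i : {w | @normal_functional R H K w} := exist _ w hw.
have := @initial_continuous _ _ (@sigma_weak_eval R H K) x.
move=> /cvg_sup/(_ i) h.
apply: (cvg_trans _ (@initial_continuous _ _
  (fun f : prod_topology (fun _ : {w | @normal_functional R H K w} => R[i]^o) => f i)
  (sigma_weak_eval x))).
have FF : Filter (nbhs x) := nbhs_filter x.
have h2 := h (@fmap_filter _ _ _ _ FF).
by move=> A hA; exact: (h2 _ hA).
Qed.

Lemma sigma_weak_cvg H K (T : Type) (F : set_system T) {FF : Filter F}
    (u : T -> 'B(H, K)) (x : 'B(H, K)) :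
  (forall w, normal_functional w -> (w (u t) : R[i]^o) @[t --> F] --> (w x : R[i]^o)) ->
  u t @[t --> F] --> x.
Proof.
move=> h; apply: (@cvg_initial _ _ (@sigma_weak_eval R H K) _ F _ u x).
apply/cvg_sup => i.
apply: (@cvg_initial _ _
  (fun f : prod_topology (fun _ : {w | @normal_functional R H K w} => R[i]^o) => f i)
  _ F _ (fun t => sigma_weak_eval (u t)) (sigma_weak_eval x)).
exact: (h _ (svalP i)).
Qed.

Lemma vector_functional_normal H K (a : H) (b : K) :
  normal_functional (fun x : 'B(H, K) => '[x a, b]).
Proof.
(* A vector functional is the normal functional of sequences supported at index 0. *)
pose first (L : hilbert R) (v : L) (n : nat) : L := if n is 0 then v else 0.
have cvg_first (f : nat -> R[i]^o) : (forall n, f n.+1 = 0) ->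
    series f @ \oo --> (f 0%N : R[i]^o).
  move=> f0; apply: cvg_near_cst; exists 1%N => // n /= n1.
  rewrite /series /= big_ltn // big_nat big1 ?addr0 // => -[|i] // _.
exists (first H a), (first K b); split.
- apply/cvg_ex; exists (`|a| ^+ 2); apply: (cvg_first (fun n => `|first H a n| ^+ 2)).
  by move=> n /=; rewrite normr0 expr0n.
- apply/cvg_ex; exists (`|b| ^+ 2); apply: (cvg_first (fun n => `|first K b n| ^+ 2)).
  by move=> n /=; rewrite normr0 expr0n.
by move=> x; apply: (cvg_first (fun n => '[x (first H a n), first K b n])) => n;
  rewrite op0 dot0l.
Qed.

Lemma dot_op_continuous H K (a : H) (b : K) :
  continuous ((fun x : 'B(H, K) => '[x a, b]) : 'B(H, K) -> R[i]^o).
Proof. exact/normal_functional_continuous/vector_functional_normal. Qed.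

Lemma within_proper (T : topologicalType) (S : set T) x :
  closure S x -> ProperFilter (within S (nbhs x)).
Proof.
move=> Sx; apply: Build_ProperFilter_ex => A /Sx[y [Sy Ay]].
by exists y; exact: Ay.
Qed.

Lemma lspan_linear (V : lmodType R[i]) (A : set V) k v w :
  lspan A v -> lspan A w -> lspan A (k *: v + w).
Proof.
move=> [n [c [f [fA ->]]]] [m [d [g [gA ->]]]].
exists (n + m)%N, (fun i => match fintype.split i with inl j => k * c j | inr j => d j end),
  (fun i => match fintype.split i with inl j => f j | inr j => g j end); split.
  by move=> i; case: fintype.split.
rewrite big_split_ord /= scaler_sumr; congr (_ + _); apply: eq_bigr => i _.
  by rewrite -[lshift m i]/(unsplit (inl i)) unsplitK scalerA.
by rewrite -[rshift n i]/(unsplit (inr i)) unsplitK.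
Qed.

Lemma lspan0 (V : lmodType R[i]) (A : set V) : lspan A 0.
Proof.
by exists 0%N, (fun=> 0), (fun=> 0); split; [case | rewrite big_ord0].
Qed.

(** Linearity and continuity are asked relative to [A] because the maps built from [DN] are
    controlled only on their domain. *)
Definition normal_form H K (A : set 'B(H, K)) (f : 'B(H, K) -> R[i]) : Prop :=
  (forall k x y, A x -> A y -> f (k *: x + y) = k * f x + f y) /\
  (forall x, A x -> (f : 'B(H, K) -> R[i]^o) y @[y --> within A (nbhs x)] --> (f x : R[i]^o)).

(** The forms agree on the span by linearity; both tend to their values along the neighbourhoods of
    [x] traced on the span, a proper filter since [x] lies in the closure. *)
Lemma normal_form_eq H K (S : set 'B(H, K)) (f g : 'B(H, K) -> R[i]) :
  normal_form (closure (lspan S)) f -> normal_form (closure (lspan S)) g ->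
  (forall x, S x -> f x = g x) -> forall x, closure (lspan S) x -> f x = g x.
Proof.
move=> [fl fc] [gl gc] fg.
have sub : lspan S `<=` closure (lspan S) by exact: subset_closure.
have form0 h : (forall k x y, closure (lspan S) x -> closure (lspan S) y ->
    h (k *: x + y) = k * h x + h y) -> h 0 = 0.
  move=> hl; have S0 := sub _ (lspan0 S).
  by have := hl (-1) 0 0 S0 S0; rewrite scaler0 addr0 mulN1r addNr.
have fg_span x : lspan S x -> f x = g x.
  move=> Sx; suff [] : lspan S x /\ f x = g x by [].
  apply: (lspan_ind (P := fun x => lspan S x /\ f x = g x)) Sx => /=.
  - by split; [exact: lspan0 | rewrite !form0].
  - move=> k v w [Sv fv] [Sw fw]; split; first exact: lspan_linear.
    by rewrite fl ?gl ?fv ?fw //; exact: sub.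
  - by move=> y Sy; split; [exact: lspan_sub | exact: fg].
move=> x Sx; have PF := within_proper Sx.
have sw : within (lspan S) (nbhs x) `=>` within (closure (lspan S)) (nbhs x).
  move=> A hA. apply: (@filterS _ (nbhs x) _ _ _ _ hA) => y yA /sub; exact: yA.
have c1 : (f : 'B(H, K) -> R[i]^o) y @[y --> within (lspan S) (nbhs x)] --> (f x : R[i]^o).
  by move=> A /(fc _ Sx) hA; exact: sw.
have c2 : (f : 'B(H, K) -> R[i]^o) y @[y --> within (lspan S) (nbhs x)] --> (g x : R[i]^o).
  move=> A /(gc _ Sx) /sw hA; rewrite nbhs_simpl /=.
  move: hA; rewrite !nbhs_simpl /= /within /= => hA.
  by apply: filterS hA => y yA Sy; rewrite /preimage /= fg_span //; exact: yA.
exact: norm_cvg_unique c1 c2.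
Qed.

Lemma vector_normal_form H K (A : set 'B(H, K)) a b :
  normal_form A (fun x => '[x a, b]).
Proof.
split=> [k x y _ _|x _]; first by rewrite opDE opZE dotDl dotZl.
apply: cvg_trans (@dot_op_continuous _ _ a b x).
by apply: cvg_app; exact: cvg_within.
Qed.

Lemma normal_on_form H K H' K' (A : set 'B(H, K)) (f : 'B(H, K) -> 'B(H', K')) a b :
  linear_on A f -> normal_on A f -> normal_form A (fun x => '[f x a, b]).
Proof.
move=> fl /subspace_continuousP fc; split=> [k x y Ax Ay|x Ax].
  by rewrite fl // opDE opZE dotDl dotZl.
exact: (cvg_comp _ _ (fc x Ax) (@dot_op_continuous _ _ a b (f x))).
Qed.

(** Slicing pulls the sequences [a n], [b n] back to [a n ⊗ c], [b n ⊗ d], which remain square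
    summable. *)
Lemma slice_r_vec_normal {tp : tensor_products R} H K H' K' (c : K) (d : K')
    (w : 'B(H, H') -> R[i]) : normal_functional w ->
  normal_functional (fun X : 'B(H ⊗ K, H' ⊗ K') => w (slice_r_vec c d X)).
Proof.
move=> [a [b [a2 b2 wE]]].
have sq (L L' : hilbert R) (v : nat -> L) (u : L') :
    cvgn (series (fun n => `|v n| ^+ 2 : R[i]^o)) ->
    cvgn (series (fun n => `|v n ⊗ᵥ u| ^+ 2 : R[i]^o)).
  move=> /cvg_ex[l vl]; apply/cvg_ex; exists (`|u| ^+ 2 * l).
  have -> : series (fun n => `|v n ⊗ᵥ u| ^+ 2 : R[i]^o) =
      (fun n => `|u| ^+ 2 *: series (fun n => `|v n| ^+ 2 : R[i]^o) n).
    apply/funext => n; rewrite /series /= scaler_sumr; apply: eq_bigr => i _.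
    by rewrite norm_tens exprMn mulrC.
  exact: cvgZr vl.
exists (fun n => a n ⊗ᵥ c), (fun n => b n ⊗ᵥ d); split; [exact: sq|exact: sq|].
move=> X; have := wE (slice_r_vec c d X).
by under [X in series X]funext do rewrite dot_slice_r_vec.
Qed.

Lemma slice_r_vec_continuous {tp : tensor_products R} H K H' K' (c : K) (d : K') :
  continuous (slice_r_vec c d : 'B(H ⊗ K, H' ⊗ K') -> 'B(H, H')).
Proof.
move=> X; have FX : Filter (nbhs X) := nbhs_filter X.
apply: (@sigma_weak_cvg _ _ _ (nbhs X) FX) => w /(slice_r_vec_normal c d) wn.
exact: (normal_functional_continuous wn).
Qed.

Lemma normal_functionalB H K (w : 'B(H, K) -> R[i]) (x y : 'B(H, K)) :
  normal_functional w -> w (x - y) = w x - w y.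
Proof.
move=> [a [b [_ _ wE]]]; apply: norm_cvg_unique (wE (x - y)) _.
have -> : series (fun n => '[(x - y : 'B(H, K)) (a n), b n] : R[i]^o) =
    (fun n => series (fun n => '[x (a n), b n] : R[i]^o) n -
              series (fun n => '[y (a n), b n] : R[i]^o) n).
  apply/funext => n; rewrite /series /= -sumrB; apply: eq_bigr => i _.
  by rewrite -dotBl.
exact: cvgB (wE x) (wE y).
Qed.

Lemma cvgn_le_bound (f : nat -> R[i]^o) : cvgn f ->
  exists2 m : R[i], 0 <= m & forall n, `|f n| <= m.
Proof.
move=> /cvg_seq_bounded[m [mr fm]]; exists (`|m| + 1); first by rewrite addr_ge0 ?ler01.
by move=> n; apply: fm => //; rewrite (le_lt_trans (real_ler_norm mr)) // ltrDl ltr01.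
Qed.

Lemma normal_functional_bounded H K (w : 'B(H, K) -> R[i]) : normal_functional w ->
  exists2 m : R[i], 0 <= m & forall (x : 'B(H, K)) c, 0 <= c ->
    (forall v, `|x v| <= c * `|v|) -> `|w x| <= c * m.
Proof.
move=> [a [b [/cvgn_le_bound[ma ma0 am] /cvgn_le_bound[mb mb0 bm] wE]]].
exists (ma + mb) => [|x c c0 xc]; first exact: addr_ge0.
apply/ler_addgt0Pr => e e0.
have /cvgrPdist_lt/(_ e e0) near_e := wE x.
have [n wn] := filter_ex near_e.
rewrite -[w x](subrK (series (fun n => '[x (a n), b n] : R[i]^o) n)) addrC.
rewrite (le_trans (ler_normD _ _)) // lerD ?(ltW wn) //.
rewrite /series /= (le_trans (ler_norm_sum _ _ _)) //.
apply: (@le_trans _ _ (\sum_(0 <= k < n) c * (`|a k| ^+ 2 + `|b k| ^+ 2))).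
  apply: ler_sum => k _; apply: le_trans (dot_le _ _) _.
  apply: (@le_trans _ _ (c * (`|a k| * `|b k|))).
    by rewrite mulrA ler_wpM2r.
  rewrite ler_wpM2l //.
  (* The square of this difference is nonnegative, so [2 |a k| |b k|] is at most the sum of squares;
     a factor 2 is given away. *)
  have rab : `|a k| - `|b k| \is Num.real by rewrite realB ?normr_real.
  have := real_exprn_even_ge0 (n := 2) rab isT.
  rewrite sqrrB addrAC subr_ge0 => /(le_trans _); apply.
  by rewrite mulr2n lerDl mulr_ge0.
rewrite -mulr_sumr ler_wpM2l // big_split /= lerD //.
  by apply: le_trans (am n); rewrite /series /= ger0_norm // sumr_ge0 // => k _; rewrite exprn_ge0.
by apply: le_trans (bm n); rewrite /series /= ger0_norm // sumr_ge0 // => k _; rewrite exprn_ge0.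
Qed.

(** The slice is linear in [c] with operator norm controlled by [|c|], and normal functionals are
    bounded. Thus norm convergence of vectors gives sigma-weak convergence of slices, the topology
    in which [N] is closed. *)
Lemma slice_r_vec_cvg {tp : tensor_products R} H K H' K' (d : K') (X : 'B(H ⊗ K, H' ⊗ K'))
    (T : Type) (F : set_system T) {FF : Filter F} (u : T -> K) (c : K) :
  u t @[t --> F] --> c ->
  slice_r_vec (u t) d X @[t --> F] --> slice_r_vec c d X.
Proof.
move=> /cvgrPdist_lt uc; apply: sigma_weak_cvg => w wn.
have [m m0 wm] := normal_functional_bounded wn.
have [C C0 XC] := op_bound (adj (ketr d) ∘ X : 'B(H ⊗ K, H')).
have C1 : 0 < C * m + 1 by rewrite ltr_wpDl ?mulr_ge0 ?ltr01.
apply/cvgrPdist_lt => e e0; near=> t.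
rewrite -normal_functionalB //.
have -> : slice_r_vec c d X - slice_r_vec (u t) d X = slice_r_vec (c - u t) d X.
  apply: op_ext => v; rewrite opBE !slice_r_vecE -!compA.
  by rewrite !comp_opE !ketrE tensBr !opB.
apply: (@le_lt_trans _ _ (C * `|c - u t| * m)).
  apply: wm => [|v]; first by rewrite mulr_ge0.
  rewrite slice_r_vecE comp_opE ketrE (le_trans (XC _)) // norm_tens.
  by rewrite -mulrA (mulrC `|v|).
rewrite (@le_lt_trans _ _ ((C * m + 1) * `|c - u t|)) //.
  by rewrite mulrAC ler_wpM2r // lerDl ler01.
rewrite mulrC -ltr_pdivlMr //; near: t; apply: uc; exact: divr_gt0.
Unshelve. all: by end_near. Qed.

End SigmaWeak.

(** * Direct sums of type I factors *)

Section RankOne.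
Context {R : realType} {H K : hilbert R}.

Lemma comp_rank_one L (x : 'B(K, L)) (a : K) (b : H) :
  x ∘ rank_one a b = rank_one (x a) b.
Proof. by apply: op_ext => c; rewrite comp_opE !rank_oneE opZ. Qed.

Lemma rank_oneZ k (a : K) (b : H) : rank_one (k *: a) b = k *: rank_one a b.
Proof. by apply: op_ext => c; rewrite opZE !rank_oneE scalerA mulrC -scalerA. Qed.

End RankOne.

Section BasisProjections.
Context {R : realType} {H : hilbert R} (n : option nat) (e : nat -> H).
Hypothesis he : orthonormal_basis n e.

(** The filter [below n k] lets [m] exceed a finite dimension, where the sequence becomes constant;
    finite and infinite blocks are thus treated alike. *)
Definition basis_projection (m : nat) : 'B(H) :=
  \sum_(k < m | below n k) rank_one (e k) (e k).

Lemma basis_projection_le m m' : (m' <= m)%N ->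
  basis_projection m ∘ basis_projection m' = basis_projection m'.
Proof.
move=> mm'; rewrite /basis_projection comp_sumr; apply: eq_bigr => k nk.
rewrite comp_rank_one op_sumE; congr rank_one.
rewrite (bigD1 (widen_ord mm' k)) //= big1 ?addr0 => [|i /andP[ni ik]].
  by rewrite rank_oneE he.1 // eqxx scale1r.
rewrite rank_oneE he.1 //.
by move: ik; rewrite -val_eqE /= eq_sym => /negbTE ->; rewrite scale0r.
Qed.

Lemma basis_projectionP m : projection (basis_projection m).
Proof.
split; last exact: basis_projection_le.
by rewrite adj_sum; apply: eq_bigr => k _; rewrite adj_rank_one.
Qed.

Lemma basis_projection_fix m k : (k < m)%N -> below n k ->
  basis_projection m (e k) = e k.
Proof.
move=> km nk; rewrite op_sumE (bigD1 (Ordinal km)) //= big1 ?addr0.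
  by rewrite rank_oneE he.1 // eqxx scale1r.
move=> i /andP[ni ik]; rewrite rank_oneE he.1 //.
by move: ik; rewrite -val_eqE /= eq_sym => /negbTE ->; rewrite scale0r.
Qed.

End BasisProjections.

(** The properties of the dual algebra on which the block calculus rests. Closedness takes the form
    of strong limits of projections, which is immediate from an intertwining relation. *)
Record star_algebra (R : realType) (K : hilbert R) (A : set 'B(K)) : Prop := {
  sta_linear : linear_subspace A;
  sta_unit : A 𝟙;
  sta_mul : forall x y, A x -> A y -> A (x ∘ y);
  sta_adj : forall x, A x -> A (adj x);
  sta_projection_limit : forall (T : Type) (F : set_system T) (p : T -> 'B(K)) q,
    ProperFilter F -> (forall t, projection (p t)) -> (forall t, A (p t)) ->
    strong_cvg F p q -> A q
}.

Section Decomposition.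
Context {R : realType} {K : hilbert R} {A : set 'B(K)}.
Context {I : countType} {H : I -> hilbert R} { pi : forall r, 'B(K) -> 'B(H r)}.
Hypothesis hA : star_algebra A.
Hypothesis hpi : linfty_sum_decomposition A pi.

Notation incl := (summand_incl A pi).

Let A_sub x y : A x -> A y -> A (x - y).
Proof.
by move=> Ax Ay; rewrite -scaleN1r addrC; exact: (sta_linear hA).2.
Qed.

Lemma pi_comp r x y : A x -> A y -> pi r (x ∘ y) = pi r x ∘ pi r y.
Proof. exact: (ush_mul (lsd_hom hpi r)). Qed.

Lemma pi_adj r x : A x -> pi r (adj x) = adj (pi r x).
Proof. exact: (ush_adj (lsd_hom hpi r)). Qed.

Lemma pi_unit r : pi r 𝟙 = 𝟙.
Proof. exact: (ush_unit (lsd_hom hpi r)). Qed.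

Lemma pi_inj x y : A x -> A y -> (forall r, pi r x = pi r y) -> x = y.
Proof.
move=> Ax Ay xy; apply: subr0_eq; apply: (lsd_inj hpi); first exact: A_sub.
move=> r; have := ush_linear (lsd_hom hpi r) (-1) Ay Ax.
by rewrite !scaleN1r [- y + x]addrC xy addNr.
Qed.

(** The family equal to [y] at [r] and 0 elsewhere is uniformly bounded, so surjectivity onto the
    direct sum provides the element. *)
Lemma inclP r (y : 'B(H r)) :
  [/\ A (incl r y), pi r (incl r y) = y & forall s, s <> r -> pi s (incl r y) = 0].
Proof.
pose f := @dfwith I (fun s => 'B(H s)) (fun s => 0) r y.
have fr : f r = y by rewrite /f dfwithin.
have f0 s : s <> r -> f s = 0.
  by move=> sr; rewrite /f dfwithout //; apply/eqP => rs; apply: sr.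
have fb : uniformly_bounded f.
  (* The bound is a nonnegative element of [R[i]], hence equal to its real part, as
     [uniformly_bounded] demands. *)
  have [c c0 yc] := op_bound y; exists (complex.Re c) => s a.
  rewrite RRe_real ?ger0_real //.
  have [sr|/f0 ->] := pselect (s = r); last by rewrite op0E normr0 mulr_ge0.
  by move: a; rewrite sr fr.
have [x Ax xf] := lsd_surj hpi fb.
apply: (@the_opP _ _ _ [set x | [/\ A x, pi r x = y & forall s, s <> r -> pi s x = 0]] x).
by split=> // [|s sr]; rewrite xf ?fr ?f0.
Qed.

Lemma incl_unique r x : A x -> (forall s, s <> r -> pi s x = 0) -> x = incl r (pi r x).
Proof.
move=> Ax x0; have [Ai ir i0] := inclP (pi r x); apply: pi_inj => // s.
have [->|sr] := pselect (s = r); first by rewrite ir.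
by rewrite i0 ?x0.
Qed.

Lemma mul_incl r x y : A x -> x ∘ incl r y = incl r (pi r x ∘ y).
Proof.
move=> Ax; have [Ai ir i0] := inclP y.
have Axi : A (x ∘ incl r y) by exact: (sta_mul hA).
rewrite (incl_unique (r := r) Axi) ?pi_comp ?ir // => s sr.
by rewrite pi_comp // i0 // comp0r.
Qed.

Lemma incl_mul r x y : A x -> incl r y ∘ x = incl r (y ∘ pi r x).
Proof.
move=> Ax; have [Ai ir i0] := inclP y.
have Axi : A (incl r y ∘ x) by exact: (sta_mul hA).
rewrite (incl_unique (r := r) Axi) ?pi_comp ?ir // => s sr.
by rewrite pi_comp // i0 // comp0l.
Qed.

Lemma incl_comp r x y : incl r x ∘ incl r y = incl r (x ∘ y).
Proof. by have [Ax xr _] := inclP x; rewrite mul_incl // xr. Qed.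

Lemma incl0 r : incl r 0 = 0.
Proof.
have [Ai ir i0] := inclP (0 : 'B(H r)); apply: (lsd_inj hpi) => // s.
by have [->|/i0] := pselect (s = r).
Qed.

Lemma incl_ortho r s x y : r <> s -> incl r x ∘ incl s y = 0.
Proof.
move=> rs; have [Ai ir i0] := inclP x.
by rewrite mul_incl // i0 ?comp0l ?incl0 // => sr; apply: rs.
Qed.

Lemma incl_adj r x : adj (incl r x) = incl r (adj x).
Proof.
have [Ai ir i0] := inclP x.
rewrite (incl_unique (r := r) (sta_adj hA Ai)) ?pi_adj ?ir // => s sr.
by rewrite pi_adj // i0 // adj0.
Qed.

Lemma incl_linear r k x y : incl r (k *: x + y) = k *: incl r x + incl r y.
Proof.
have [Ax xr x0] := inclP x; have [Ay yr y0] := inclP y.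
have Axy : A (k *: incl r x + incl r y) by exact: (sta_linear hA).2.
rewrite (incl_unique (r := r) Axy); last first.
  by move=> s sr; rewrite (ush_linear (lsd_hom hpi s)) // x0 // y0 // scaler0 addr0.
by rewrite (ush_linear (lsd_hom hpi r)) // xr yr.
Qed.

Lemma inclZ r k x : incl r (k *: x) = k *: incl r x.
Proof. by rewrite -[k *: x]addr0 incl_linear incl0 addr0. Qed.

Lemma incl_sum r (J : Type) (s : seq J) (P : pred J) (F : J -> 'B(H r)) :
  incl r (\sum_(j <- s | P j) F j) = \sum_(j <- s | P j) incl r (F j).
Proof.
apply: (big_morph (incl r)) => [x y|]; last exact: incl0.
by rewrite -[x]scale1r incl_linear !scale1r.
Qed.

Lemma incl_projection r p : projection p -> projection (incl r p).
Proof. by move=> [pa pp]; split; rewrite ?incl_adj ?pa // incl_comp pp. Qed.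

Lemma incl_unit_central r x : A x -> x ∘ incl r 𝟙 = incl r 𝟙 ∘ x.
Proof. by move=> Ax; rewrite mul_incl // incl_mul // comp1 comp1l. Qed.

(* The limit of the increasing projections lies in [A], so that it can be
   identified through [pi]; no normality of the inverse of [pi] is needed. *)
Lemma basis_projection_cvg r n e : orthonormal_basis n e ->
  strong_cvg \oo (fun m => incl r (basis_projection n e m)) (incl r 𝟙).
Proof.
move=> he; set P := fun m => _.
have Pproj m : projection (P m) by apply/incl_projection/basis_projectionP.
have [|q Pq] := @increasing_projections_cvg _ _ _ \oo _ P Pproj.
  by move=> m0; exists m0 => // m /= mm0; rewrite incl_comp basis_projection_le.
have AP m : A (P m) by have [] := inclP (basis_projection n e m).
have Aq : A q by exact: (sta_projection_limit hA _ Pproj AP Pq).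
suff <- : q = incl r 𝟙 by [].
suff pq : pi r q = 𝟙.
  (* For [s <> r] the unit of block [s] kills every approximating projection, hence also [q], and
     [pi s] maps that unit to 1. *)
  rewrite -pq; apply: incl_unique => // s sr.
  have [As spi _] := inclP (𝟙 : 'B(H s)).
  rewrite -[pi s q]comp1l -[in LHS]spi -pi_comp //.
  have -> : incl s 𝟙 ∘ q = 0.
    apply: op_ext => v; rewrite comp_opE op0E.
    have c1 : incl s 𝟙 (P m v) @[m --> \oo] --> incl s 𝟙 (q v) by apply: op_cvg; exact: Pq.
    have c2 : incl s 𝟙 (P m v) @[m --> \oo] --> (0 : K).
      under eq_cvg do rewrite -comp_opE incl_ortho //.
      exact: cvg_cst.
    exact: norm_cvg_unique c1 c2.
  have A0 : A 0 := (sta_linear hA).1.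
  have := ush_linear (lsd_hom hpi s) (-1) A0 A0.
  by rewrite scaler0 addr0 scaleN1r addNr.
apply: (op_ext_total he.2) => _ [k nk <-].
set u := incl r (rank_one (e k) (e k)).
have [Au ur _] := inclP (rank_one (e k) (e k)).
(* The projections fix the range of the diagonal unit [u] as soon as [m > k]; reading this through
   [pi r] gives [pi r q (e k) = e k]. *)
have qu : q ∘ u = u.
  apply: op_ext => v; rewrite comp_opE.
  have c1 := Pq (u v); apply: (norm_cvg_unique c1); apply: cvg_near_cst.
  exists k.+1 => // m /= km; rewrite -comp_opE /P incl_comp comp_rank_one.
  by rewrite basis_projection_fix.
have := congr1 (fun x => pi r x (e k)) qu.
by rewrite /= pi_comp // /u ur comp_opE rank_oneE he.1 // eqxx scale1r.
Qed.

Let summands_comp (J : {fset I}) r : r \in J ->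
  partial_sum (fun r => incl r 𝟙) J ∘ incl r 𝟙 = incl r 𝟙.
Proof.
move=> rJ; rewrite /partial_sum comp_suml (bigD1 [` rJ]%fset) //= big1 ?addr0.
  by rewrite incl_comp comp1.
move=> s; rewrite -val_eqE /= => sr; apply: incl_ortho; exact/eqP.
Qed.

Lemma summands_projection (J : {fset I}) : projection (partial_sum (fun r => incl r 𝟙) J).
Proof.
split; first by rewrite adj_sum; apply: eq_bigr => r _; rewrite incl_adj adj1.
by rewrite comp_sumr; apply: eq_bigr => r _; apply: summands_comp; exact: valP.
Qed.

(** The strong limit [q] lies in the algebra and fixes each block unit, so every [pi r q] is 1 and
    joint injectivity of the [pi r] gives [q = 1]. *)
Lemma summands_cvg : strong_cvg totally (partial_sum (fun r => incl r 𝟙)) 𝟙.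
Proof.
set p := fun r => _; have pp := summands_comp; have Pproj := summands_projection.
have [|q Pq] := @increasing_projections_cvg _ _ _ totally totally_filter (partial_sum p) Pproj.
  move=> J0; exists J0 => // J /= J0J; rewrite comp_sumr; apply: eq_bigr => r _.
  apply: pp; apply: (fsubsetP J0J); exact: valP.
have Ap r : A (p r) by have [] := inclP (𝟙 : 'B(H r)).
have AP J : A (partial_sum p J).
  rewrite /partial_sum; elim/big_ind: _ => //; first exact: (sta_linear hA).1.
  by move=> x y Ax Ay; rewrite -[x]scale1r; exact: (sta_linear hA).2.
have Aq : A q by exact: (sta_projection_limit hA totally_filter Pproj AP Pq).
suff <- : q = 𝟙 by [].
apply: pi_inj => // [|r]; first exact: sta_unit.
have [_ pr _] := inclP (𝟙 : 'B(H r)).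
have qp : q ∘ incl r 𝟙 = incl r 𝟙.
  rewrite -[incl r 𝟙]/(p r); apply: op_ext => v; rewrite comp_opE.
  have c1 := Pq (p r v); apply: (@norm_cvg_unique _ _ _ (fmap_proper_filter _ totally_filter) _ _ c1).
  apply: (@cvg_near_cst _ _ _ _ _ totally_filter).
  exists [fset r]%fset => // J /= rJ; rewrite -comp_opE pp //.
  by apply: (fsubsetP rJ); rewrite inE.
by rewrite pi_unit -[pi r q]comp1 -[in LHS]pr -pi_comp ?qp //; exact: Ap.
Qed.

(* [f] is an orthonormal family in [K] on which [A] acts as [pi r A] does on the
   basis [e]. *)
Definition adapted_family r n (e : nat -> H r) (f : nat -> K) : Prop :=
  forall i j, below n i -> below n j ->
    [/\ '[f i, f j] = (i == j)%:R, incl r 𝟙 (f i) = f i,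
        forall k, below n k -> incl r (rank_one (e i) (e j)) (f k) = (j == k)%:R *: f i,
        forall x, A x -> incl r (rank_one (e i) (e i)) (x (f j)) =
          '[pi r x (e j), e i] *: f i &
        forall x, A x -> '[x (f j), f i] = '[pi r x (e j), e i]].

(* The family is the orbit, under the matrix units, of a unit vector in the
   range of a minimal projection. *)
Lemma adapted_family_exists r n e : orthonormal_basis n e -> below n 0 ->
  exists f : nat -> K, @adapted_family r n e f.
Proof.
move=> he n0.
pose u (i j : nat) := incl r (rank_one (e i) (e j)).
have u00 : u 0%N 0%N != 0.
  apply/eqP => u0; have [_ ur _] := inclP (rank_one (e 0%N) (e 0%N)).
  have := congr1 (fun x : 'B(H r) => x (e 0%N)) ur.
  rewrite -/(u 0%N 0%N) u0 -(incl0 r).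
  have [_ -> _] := inclP (0 : 'B(H r)).
  rewrite rank_oneE he.1 // eqxx scale1r op0E => e0.
  have := he.1 0%N 0%N n0 n0; rewrite -e0 dot0l => /esym/eqP.
  by rewrite eqxx oner_eq0.
have [eta eta1 ueta] : exists2 eta : K, '[eta, eta] = 1 & u 0%N 0%N eta = eta.
  have [v uv] : exists v, u 0%N 0%N v != 0.
    apply: contrapT => /forallNP uv; move/eqP: u00; apply; apply: op_ext => v.
    by have /negP := uv v; rewrite op0E negbK => /eqP.
  exists (`|u 0%N 0%N v|^-1 *: u 0%N 0%N v).
    rewrite dotaa normrZ normfV normr_id mulVf ?expr1n // normr_eq0 //.
  rewrite opZ -comp_opE /u incl_comp comp_rank_one rank_oneE he.1 //.
  by rewrite eqxx scale1r.
have uu i j k l : below n i -> below n j -> below n k ->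
    u i j ∘ u k l = (j == k)%:R *: u i l.
  move=> ni nj nk; rewrite /u incl_comp comp_rank_one rank_oneE he.1 //.
  by rewrite eq_sym rank_oneZ inclZ.
exists (fun i => u i 0%N eta) => i j ni nj.
have F1 i' j' k : below n i' -> below n j' -> below n k ->
    u i' j' (u k 0%N eta) = (j' == k)%:R *: u i' 0%N eta.
  by move=> ni' nj' nk; rewrite -comp_opE uu.
have au i' j' : adj (u i' j') = u j' i' by rewrite /u incl_adj adj_rank_one.
have F2 i' j' : below n i' -> below n j' ->
    '[u i' 0%N eta, u j' 0%N eta] = (i' == j')%:R.
  move=> ni' nj'; rewrite -dot_adjl au F1 // dotZl ueta eta1 mulr1.
  by rewrite eq_sym.
(* Inside the block, [e_ii x e_j0] is the matrix coefficient of [x] times [e_i0]. *)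
have F3 x i' j' : A x -> below n i' -> below n j' ->
    u i' i' (x (u j' 0%N eta)) = '[pi r x (e j'), e i'] *: u i' 0%N eta.
  move=> Ax ni' nj'; rewrite -2!comp_opE /u -compA mul_incl // incl_comp.
  by rewrite !comp_rank_one rank_oneE rank_oneZ inclZ.
split=> //.
- exact: F2.
- by rewrite -comp_opE incl_comp comp1l.
- by move=> k nk; exact: F1.
- by move=> x Ax; exact: F3.
move=> x Ax; have -> : u i 0%N eta = u i i (u i 0%N eta) by rewrite F1 // eqxx scale1r.
by rewrite -dot_adjl au F3 // dotZl F2 // eqxx mulr1.
Qed.

End Decomposition.

(** * Galois co-objects *)

Section TripleTensors.
Context {R : realType} {tp : tensor_products R}.
Implicit Types H K L : hilbert R.

Lemma adj_ketl_assoc H K L (a : H) (Z : H ⊗ K) (c : L) :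
  adj (ketl a) (assoc H K L (Z ⊗ᵥ c)) = adj (ketl a) Z ⊗ᵥ c.
Proof.
rewrite -!ketrE -!comp_opE; congr (bounded_op_fun _ Z).
apply: op_ext_pure => p q; rewrite !comp_opE !ketrE assocE !adj_ketlE.
by rewrite tensZl.
Qed.

Lemma adj_ketl_tensor_op H K L (a : H) (x : 'B(K, L)) (Z : H ⊗ K) :
  adj (ketl a) ((𝟙 ⊗ₒ x) Z) = x (adj (ketl a) Z).
Proof.
rewrite -!comp_opE; congr (bounded_op_fun _ Z).
by apply: op_ext_pure => p q; rewrite !comp_opE tensor_opE !adj_ketlE opZ.
Qed.

End TripleTensors.

(** Unitarity of [V] turns invariance into the intertwining [(x ⊗ 1) V = V (x ⊗ 1)], with [x ⊗ 1] on
    [K ⊗ K] to the left and on [K ⊗ H] to the right; this is linear, multiplicative and stable under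
    strong limits. *)
Lemma dual_star_algebra (R : realType) (tp : tensor_products R) (H K : hilbert R)
    (V : 'B(K ⊗ H, K ⊗ K)) : Defs.is_unitary V -> star_algebra (dual_algebra V).
Proof.
move=> [V1 V2]; have dualP x : dual_algebra V x <-> (x ⊗ₒ 𝟙) ∘ V = V ∘ (x ⊗ₒ 𝟙).
  split=> [h|h]; last by rewrite /dual_algebra /= -compA h compA V1 comp1l.
  by rewrite -[in RHS]h !compA V2 comp1l.
split.
- have tl k (L : hilbert R) (x y : 'B(K)) :
      (k *: x + y) ⊗ₒ (𝟙 : 'B(L)) = k *: (x ⊗ₒ 𝟙) + y ⊗ₒ 𝟙.
    apply: op_ext_pure => a b; rewrite opDE opZE !tensor_opE opDE opZE.
    by rewrite tensDl tensZl.
  split=> [|k x y /dualP xV /dualP yV]; apply/dualP; last first.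
    rewrite !tl compDl compZl xV yV; apply: op_ext => v.
    by rewrite opDE opZE !comp_opE opDE opZE opD opZ.
  have t0 (L : hilbert R) : (0 : 'B(K)) ⊗ₒ (𝟙 : 'B(L)) = 0.
    by apply: op_ext_pure => a b; rewrite tensor_opE !op0E -ketrE op0.
  by rewrite !t0 comp0l comp0r.
- by apply/dualP; rewrite !tensor_op1 comp1 comp1l.
- move=> x y /dualP xV /dualP yV; apply/dualP.
  have t (L : hilbert R) : (x ∘ y) ⊗ₒ (𝟙 : 'B(L)) = (x ⊗ₒ 𝟙) ∘ (y ⊗ₒ 𝟙).
    by rewrite -tensor_op_comp comp1.
  by rewrite !t -compA yV compA xV compA.
- move=> x; rewrite /dual_algebra /= => xV.
  have := congr1 (@adj R _ _) xV.
  by rewrite !adj_comp !adj_tensor_op !adj1 adjK compA.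
move=> T F p q FF pP pA pq; apply/dualP; apply: op_ext => X; rewrite !comp_opE.
have c1 : (p t ⊗ₒ 𝟙) (V X) @[t --> F] --> (q ⊗ₒ 𝟙) (V X) by apply: tensor_strong_cvgl.
have c2 : (p t ⊗ₒ 𝟙) (V X) @[t --> F] --> V ((q ⊗ₒ 𝟙) X).
  have e t : (p t ⊗ₒ 𝟙) (V X) = V ((p t ⊗ₒ 𝟙) X).
    by rewrite -!comp_opE ((dualP _).1 (pA t)).
  under eq_cvg do rewrite e.
  by apply: op_cvg; apply: tensor_strong_cvgl.
exact: norm_cvg_unique c1 c2.
Qed.

Section GaloisCoobject.
Context {R : realType} {tp : tensor_products R} {H K : hilbert R}.
Context {M : set 'B(H)} {DM : 'B(H) -> 'B(H ⊗ H)} {xi : H}.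
Context {N : set 'B(H, K)} {DN : 'B(H, K) -> 'B(H ⊗ H, K ⊗ K)}.
Hypothesis hM : compact_woronowicz M DM xi.
Hypothesis hN : right_galois_coobject M DM N DN.
Context {V : 'B(K ⊗ H, K ⊗ K)} {W : 'B(K ⊗ K, H ⊗ K)}.
Hypothesis hV : is_Vtilde xi N DN V.
Hypothesis hW : is_Wtilde xi N DN W.

Let NN := tensor_space_op N N.

Lemma N_lin k x y : N x -> N y -> N (k *: x + y).
Proof. exact: (rgc_subspace hN).2. Qed.

(** By cyclicity [x a] is approximated by [x (m xi)] with [m] in [M], and [x ∘ m] lies in [N]; the
    vectors [x a] are total. *)
Lemma closure_N_xi : closure [set (x : 'B(H, K)) xi | x in N] = setT.
Proof.
apply/seteqP; split=> // v _.
pose P (v : K) := forall e : R[i], 0 < e -> exists2 x : 'B(H, K), N x & `|v - x xi| < e.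
suff Pv : P v.
  by apply/closure_normP => e e0; have [x Nx vx] := Pv e e0; exists (x xi) => //; exists x.
have e2 (e : R[i]) : 0 < e -> 0 < e / 2 by move=> e0; rewrite divr_gt0 // ltr0n.
move: v; apply: (total_ind (P := P) (rgc_dense hN)).
- by move=> e e0; exists 0; [exact: (rgc_subspace hN).1 | rewrite op0E subrr normr0].
- move=> k a b Pa Pb e e0; have k0 : 0 < `|k| + 1 by rewrite ltr_wpDl ?ltr01.
  have [x Nx ax] := Pa _ (divr_gt0 (e2 _ e0) k0); have [y Ny bY] := Pb _ (e2 _ e0).
  exists (k *: x + y); first exact: N_lin.
  rewrite opDE opZE opprD addrACA -scalerBr (le_lt_trans (ler_normD _ _)) //.
  rewrite [e]splitr ler_ltD // normrZ.
  apply: (@le_trans _ _ ((`|k| + 1) * `|a - x xi|)).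
    by rewrite ler_wpM2r // lerDl ler01.
  by rewrite mulrC -ler_pdivlMr // ltW.
- move=> a aP e e0; have [b Pb ab] := aP _ (e2 _ e0).
  have [x Nx bx] := Pb _ (e2 _ e0); exists x => //.
  have -> : a - x xi = (a - b) + (b - x xi) by rewrite subrKA.
  by rewrite (le_lt_trans (ler_normD _ _)) // [e]splitr ltrD.
move=> _ [x Nx] [a _ <-] e e0; have [c c0 xc] := op_bound x.
have c1 : 0 < c + 1 by rewrite ltr_wpDl ?ltr01.
have : closure [set (m : 'B(H)) xi | m in M] a by rewrite (cwa_cyclic hM).
move=> /closure_normP/(_ _ (divr_gt0 e0 c1))[_ [m Mm <-] am].
exists (x ∘ m); first exact: (rgc_module hN).
rewrite comp_opE -opB (le_lt_trans (xc _)) //.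
apply: (@le_lt_trans _ _ ((c + 1) * `|a - m xi|)).
  by rewrite ler_wpM2r // lerDl ler01.
by rewrite mulrC -ltr_pdivlMr.
Qed.

Lemma total_N_xi : total_set [set v | exists2 x : 'B(H, K), N x & v = x xi].
Proof.
rewrite /total_set; apply/seteqP; split=> // v _.
have : closure [set (x : 'B(H, K)) xi | x in N] v by rewrite closure_N_xi.
apply: closureS => _ [x Nx <-]; apply: lspan_sub; by exists x.
Qed.

(** An elementary tensor has a multiple of its first factor as slice; slicing is sigma-weakly
    continuous and [N] is closed. *)
Lemma slice_N c d X : NN X -> N (slice_r_vec c d X).
Proof.
move=> NX; have PF := within_proper NX.
have cX := @slice_r_vec_continuous R tp H H K K c d X.
set S := lspan _ in PF.
have SN Y : S Y -> N (slice_r_vec c d Y).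
  apply: (lspan_ind (P := fun Y => N (slice_r_vec c d Y))).
  - have -> : slice_r_vec c d (0 : 'B(H ⊗ H, K ⊗ K)) = 0.
      by rewrite slice_r_vecE comp0r comp0l.
    exact: (rgc_subspace hN).1.
  - move=> k Y' Z NY' NZ.
    have -> : slice_r_vec c d (k *: Y' + Z) = k *: slice_r_vec c d Y' + slice_r_vec c d Z.
      apply: op_ext => a; apply: dot_inj => b.
      by rewrite opDE opZE dotDl dotZl !dot_slice_r_vec opDE opZE dotDl dotZl.
    exact: N_lin.
  move=> _ [y Ny] [z Nz <-].
  have -> : slice_r_vec c d (y ⊗ₒ z) = '[z c, d] *: y + 0.
    apply: op_ext => a; apply: dot_inj => b.
    by rewrite addr0 dot_slice_r_vec tensor_opE dot_tens opZE dotZl mulrC.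
  by apply: N_lin => //; exact: (rgc_subspace hN).1.
have cS : slice_r_vec c d Y @[Y --> within S (nbhs X)] --> slice_r_vec c d X.
  by move=> B /cX hB; exact: (cvg_within S hB).
apply: (closed_cvg N (rgc_closed hN) _ _ cS).
by apply: filterS (withinT S (nbhs_filter X)) => Y; exact: SN.
Qed.

Lemma DN0 : DN 0 = 0.
Proof.
have N0 := (rgc_subspace hN).1.
by have := rgc_linear hN (-1) N0 N0; rewrite scaler0 addr0 scaleN1r addNr.
Qed.

Lemma DN_slice_form c d a b :
  normal_form NN (fun X => '[DN (slice_r_vec c d X) a, b]).
Proof.
have NN_slice X : NN X -> N (slice_r_vec c d X) by exact: slice_N.
split=> [k X Y /NN_slice NX /NN_slice NY|X NX].
  have -> : slice_r_vec c d (k *: X + Y) = k *: slice_r_vec c d X + slice_r_vec c d Y.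
    apply: op_ext => u; apply: dot_inj => v.
    by rewrite opDE opZE dotDl dotZl !dot_slice_r_vec opDE opZE dotDl dotZl.
  by rewrite (rgc_linear hN) // opDE opZE dotDl dotZl.
have [_ fc] := normal_on_form a b (rgc_linear hN) (rgc_normal hN).
move=> B /(fc _ (NN_slice _ NX)) hB.
have := @slice_r_vec_continuous R tp H H K K c d X _ hB.
rewrite !nbhs_simpl /= /within /=; apply: filterS => Y hY NY.
by apply: hY; exact: NN_slice.
Qed.

Section TensorMaps.
Variables (F : 'B(H ⊗ H, K ⊗ K) -> 'B((H ⊗ H) ⊗ H, (K ⊗ K) ⊗ K))
          (G : 'B(H ⊗ H, K ⊗ K) -> 'B(H ⊗ (H ⊗ H), K ⊗ (K ⊗ K))).
Hypotheses (hF : is_tensor_map N N DN id F) (hG : is_tensor_map N N id DN G).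

Lemma G_Vtilde X a b : NN X ->
  G X (a ⊗ᵥ (xi ⊗ᵥ b)) = (𝟙 ⊗ₒ V) (assoc K K H (X (a ⊗ᵥ xi) ⊗ᵥ b)).
Proof.
move=> NX; apply: dot_inj => c.
(* Writing the right side as one fixed operator applied to [Y (a ⊗ xi)] makes its pairing with [c] a
   vector functional of [Y]. *)
have e Y : (𝟙 ⊗ₒ V) (assoc K K H (Y (a ⊗ᵥ xi) ⊗ᵥ b)) =
    ((𝟙 ⊗ₒ V) ∘ assoc K K H ∘ ketr b) (Y (a ⊗ᵥ xi)) by rewrite !comp_opE ketrE.
rewrite e [RHS]dot_adj.
move: X NX; apply: normal_form_eq.
- exact: (normal_on_form _ _ (itm_linear hG) (itm_normal hG)).
- exact: vector_normal_form.
move=> _ [y Ny] [z Nz <-]; rewrite -dot_adj -e (itm_pure hG) //.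
by rewrite !tensor_opE assocE tensor_opE (vt_eq hV).
Qed.

Lemma F_Wtilde X a b : NN X ->
  F X ((a ⊗ᵥ xi) ⊗ᵥ b) = (adj W ⊗ₒ 𝟙) (adj (assoc H K K) (a ⊗ᵥ X (xi ⊗ᵥ b))).
Proof.
move=> NX; apply: dot_inj => c.
have e Y : (adj W ⊗ₒ 𝟙) (adj (assoc H K K) (a ⊗ᵥ Y (xi ⊗ᵥ b))) =
    ((adj W ⊗ₒ 𝟙) ∘ adj (assoc H K K) ∘ ketl a) (Y (xi ⊗ᵥ b)) by rewrite !comp_opE ketlE.
rewrite e [RHS]dot_adj.
move: X NX; apply: normal_form_eq.
- exact: (normal_on_form _ _ (itm_linear hF) (itm_normal hF)).
- exact: vector_normal_form.
move=> _ [y Ny] [z Nz <-]; rewrite -dot_adj -e (itm_pure hF) //.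
by rewrite !tensor_opE adj_assocE tensor_opE (wt_eq hW).
Qed.

(** Slicing the last leg commutes with [DN] on the first, evident on elementary tensors. *)
Lemma F_slice X d a b : NN X ->
  '[DN (slice_r_vec xi d X) a, b] = '[F X (a ⊗ᵥ xi), b ⊗ᵥ d].
Proof.
move: X; apply: normal_form_eq.
- exact: DN_slice_form.
- exact: (normal_on_form _ _ (itm_linear hF) (itm_normal hF)).
move=> _ [y Ny] [z Nz <-]; rewrite (itm_pure hF) // tensor_opE dot_tens.
have -> : slice_r_vec xi d (y ⊗ₒ z) = '[z xi, d] *: y + 0.
  apply: op_ext => u; apply: dot_inj => v.
  by rewrite addr0 dot_slice_r_vec tensor_opE dot_tens opZE dotZl mulrC.
rewrite (rgc_linear hN) //; last exact: (rgc_subspace hN).1.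
by rewrite DN0 addr0 opZE dotZl mulrC.
Qed.

Lemma G_Wtilde X a b : NN X ->
  G X (a ⊗ᵥ (b ⊗ᵥ xi)) = (𝟙 ⊗ₒ (adj W ∘ ketl b)) (X (a ⊗ᵥ xi)).
Proof.
move=> NX; apply: dot_inj => c; rewrite [RHS]dot_adj.
move: X NX; apply: normal_form_eq.
- exact: (normal_on_form _ _ (itm_linear hG) (itm_normal hG)).
- exact: vector_normal_form.
move=> _ [y Ny] [z Nz <-]; rewrite -dot_adj (itm_pure hG) //.
by rewrite !tensor_opE comp_opE ketlE (wt_eq hW).
Qed.

End TensorMaps.

(* Both sides are the two forms of [(Δ_N ⊗ ι)Δ_N] at [a ⊗ xi ⊗ b]. *)
Lemma Wtilde_Vtilde a c b :
  assoc K K K ((adj W ⊗ₒ 𝟙) (adj (assoc H K K) ((𝟙 ⊗ₒ V) (a ⊗ᵥ (c ⊗ᵥ b))))) =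
  (𝟙 ⊗ₒ V) (assoc K K H (adj W (a ⊗ᵥ c) ⊗ᵥ b)).
Proof.
have [F [G [hF hG co]]] := rgc_coassociative hN.
pose x1 : 'B(K, K ⊗ (K ⊗ K)) := assoc K K K ∘ (adj W ⊗ₒ 𝟙) ∘ adj (assoc H K K) ∘ (𝟙 ⊗ₒ V) ∘ ketl a ∘ ketr b.
pose x2 : 'B(K, K ⊗ (K ⊗ K)) := (𝟙 ⊗ₒ V) ∘ assoc K K H ∘ ketr b ∘ adj W ∘ ketl a.
suff : x1 = x2.
  move=> /(congr1 (fun x : 'B(K, K ⊗ (K ⊗ K)) => x c)).
  by rewrite /x1 /x2 /= !ketrE !ketlE.
apply: (op_ext_total total_N_xi) => _ [x Nx ->].
rewrite /x1 /x2 !comp_opE !ketrE !ketlE tensor_opE (vt_eq hV) // (wt_eq hW) //.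
have NX := rgc_range hN Nx.
rewrite -(F_Wtilde hF) // -(G_Vtilde hG) // -assocE -!comp_opE.
by rewrite (co _ Nx).
Qed.

(** Contract the first leg of [Wtilde_Vtilde] against [a']: what remains of [W^*] is the slice,
    acting on the first leg of [V]. *)
Lemma slice_adj_Wtilde_commute a a' :
  (slice_l_vec a a' (adj W) ⊗ₒ 𝟙) ∘ V = V ∘ (slice_l_vec a a' (adj W) ⊗ₒ 𝟙).
Proof.
rewrite slice_l_vecE; set y := _ ∘ _ ∘ _.
have y1 : y ⊗ₒ 𝟙 = adj (ketl a') ∘ assoc K K K ∘ (adj W ⊗ₒ 𝟙) ∘
    adj (assoc H K K) ∘ ketl a.
  apply: op_ext_pure => p q; rewrite !comp_opE tensor_opE ketlE adj_assocE tensor_opE.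
  by rewrite adj_ketl_assoc /y !comp_opE ketlE.
apply: op_ext_pure => c b; rewrite !comp_opE y1 tensor_opE !comp_opE ketlE.
have -> : a ⊗ᵥ V (c ⊗ᵥ b) = (𝟙 ⊗ₒ V) (a ⊗ᵥ (c ⊗ᵥ b)) by rewrite tensor_opE.
by rewrite Wtilde_Vtilde adj_ketl_tensor_op adj_ketl_assoc /y /= ?ketlE.
Qed.

Lemma dual_slice_adj a a' : dual_algebra V (slice_l_vec a a' (adj W)).
Proof.
have [V1 _] := vt_unitary hV.
by rewrite /dual_algebra /= -compA slice_adj_Wtilde_commute compA V1 comp1l.
Qed.

Lemma dual_slice a a' : dual_algebra V (slice_l_vec a a' W).
Proof.
rewrite -[slice_l_vec a a' W]adjK adj_slice_l_vec.
exact: (sta_adj (dual_star_algebra (vt_unitary hV)) (dual_slice_adj _ _)).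
Qed.

Lemma slice_Wtilde_xi x d : N x ->
  slice_r_vec (x xi) d (adj W) = slice_r_vec xi d (DN x).
Proof.
move=> Nx; apply: op_ext => a; apply: dot_inj => b.
by rewrite !dot_slice_r_vec (wt_eq hW).
Qed.

(** Vectors [x xi] approaching [c]: along this filter the slices of [W^*] are slices of [DN x], by
    [slice_Wtilde_xi]. *)
Let near_N_xi (c : K) : set_system K := within [set (x : 'B(H, K)) xi | x in N] (nbhs (c : K)).

Let near_N_xi_proper (c : K) : ProperFilter (near_N_xi c).
Proof. by apply: within_proper; rewrite closure_N_xi. Qed.

Let slice_near_N_xi c d :
  slice_r_vec c' d (adj W) @[c' --> near_N_xi c] --> slice_r_vec c d (adj W).
Proof.
apply: (@slice_r_vec_cvg R tp H K K K d (adj W) _ (near_N_xi c) _ id).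
by move=> B hB; exact: cvg_within hB.
Qed.

Lemma slice_adj_Wtilde_N c d : N (slice_r_vec c d (adj W)).
Proof.
have PF := near_N_xi_proper c.
apply: (closed_cvg N (rgc_closed hN) _ _ (@slice_near_N_xi c d)).
apply: (@filterS _ (near_N_xi c) _ _ _ _ (withinT _ (nbhs_filter c))) => _ [x Nx <-].
by rewrite slice_Wtilde_xi //; apply: slice_N; exact: (rgc_range hN).
Qed.

Lemma DN_slice_adj_Wtilde c d a b a' b' :
  '[DN (slice_r_vec c d (adj W)) (a ⊗ᵥ b), a' ⊗ᵥ b'] =
  '[(𝟙 ⊗ₒ (adj W ∘ ketl b)) (adj W (a ⊗ᵥ c)), a' ⊗ᵥ (b' ⊗ᵥ d)].
Proof.
have [F [G [hF hG co]]] := rgc_coassociative hN.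
have PF := near_N_xi_proper c.
pose f c := '[DN (slice_r_vec c d (adj W)) (a ⊗ᵥ b), a' ⊗ᵥ b'] : R[i]^o.
have c1 : f c' @[c' --> near_N_xi c] --> f c.
  have [_ fc] := normal_on_form (a ⊗ᵥ b) (a' ⊗ᵥ b') (rgc_linear hN) (rgc_normal hN).
  move=> B /(fc _ (slice_adj_Wtilde_N c d)) hB.
  apply: (@filterS _ (near_N_xi c) _ _ _ _ (slice_near_N_xi hB)) => c'; apply.
  exact: slice_adj_Wtilde_N.
apply: norm_cvg_unique c1 _.
pose g c := '[(𝟙 ⊗ₒ (adj W ∘ ketl b)) (adj W (a ⊗ᵥ c)), a' ⊗ᵥ (b' ⊗ᵥ d)] : R[i]^o.
have c2 : g c' @[c' --> near_N_xi c] --> g c.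
  apply: cvg_dotl; under eq_cvg do rewrite -ketlE.
  rewrite /g -ketlE; do 3 (apply: op_cvg).
  by move=> B hB; exact: cvg_within hB.
suff fg : \forall c' \near near_N_xi c, g c' = f c' by exact: (cvg_trans (near_eq_cvg fg) c2).
apply: (@filterS _ (near_N_xi c) _ _ _ _ (withinT _ (nbhs_filter c))) => _ [x Nx <-].
have NX : NN (DN x) by exact: (rgc_range hN).
rewrite /f /g slice_Wtilde_xi // (F_slice hF) //.
rewrite -(adj_assocE a' b' d) -dot_adj -[assoc K K K _]comp_opE (co _ Nx) comp_opE assocE.
by rewrite (G_Wtilde hG) // (wt_eq hW).
Qed.

(** At [c = x xi] both sides are [DN x (xi ⊗ xi)]. *)
Lemma Vtilde_xi c : V (c ⊗ᵥ xi) = adj W (xi ⊗ᵥ c).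
Proof.
suff h : V ∘ ketr xi = adj W ∘ ketl xi.
  by have := congr1 (fun x : 'B(K, K ⊗ K) => x c) h; rewrite /= ketrE ketlE.
apply: (op_ext_total total_N_xi) => _ [x Nx ->].
by rewrite !comp_opE ketrE ketlE (vt_eq hV) // (wt_eq hW).
Qed.

End GaloisCoobject.

(** * Coefficients of the dual corepresentation *)

Section StrongConvergence.
Context {R : realType}.
Implicit Types H K L : hilbert R.

Lemma strong_star_sandwich H K L (T : Type) (F : set_system T) {FF : Filter F}
    (p : T -> 'B(K)) (q : 'B(K)) (x : 'B(K, L)) (y : 'B(H, K)) :
  (forall t, projection (p t)) -> projection q -> strong_cvg F p q ->
  strong_star_cvg F (fun t => x ∘ p t ∘ y) (x ∘ q ∘ y).
Proof.
move=> pP qP pq; split=> v.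
  rewrite !comp_opE; under eq_cvg do rewrite !comp_opE.
  by apply: op_cvg; exact: pq.
under eq_cvg do rewrite !adj_comp (pP _).1 !comp_opE.
by rewrite !adj_comp qP.1 !comp_opE; apply: op_cvg; exact: pq.
Qed.

(** Products are jointly strongly continuous here because the left factors are contractions. *)
Lemma strong_cvg_mul H K (T : Type) (F : set_system T) {FF : Filter F}
    (p : T -> 'B(K)) (p' : 'B(K)) (q : T -> 'B(H)) (q' : 'B(H)) (x : 'B(H, K)) :
  (forall t, projection (p t)) -> strong_cvg F p p' -> strong_cvg F q q' ->
  strong_cvg F (fun t => p t ∘ x ∘ q t) (p' ∘ x ∘ q').
Proof.
move=> pP pp' qq' v.
have c1 := pp' (x (q' v)).
have c2 : x (q t v) @[t --> F] --> x (q' v) by apply: op_cvg; exact: qq'.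
apply/cvgrPdist_lt => e e0.
have e2 : 0 < e / 2 by rewrite divr_gt0 // ltr0n.
move/cvgrPdist_lt: c1 => /(_ _ e2) near1; move/cvgrPdist_lt: c2 => /(_ _ e2) near2.
near=> t; rewrite !comp_opE.
have -> : p' (x (q' v)) - p t (x (q t v)) =
    (p' (x (q' v)) - p t (x (q' v))) + p t (x (q' v) - x (q t v)).
  by rewrite [in RHS]opB subrKA.
rewrite (le_lt_trans (ler_normD _ _)) // [e]splitr ltrD //; first by near: t.
by rewrite (le_lt_trans (projection_norm _ (pP t))) //; near: t.
Unshelve. all: by end_near. Qed.

End StrongConvergence.

Section SlicesInAlgebra.
Context {R : realType} {tp : tensor_products R} {K : hilbert R} {A : set 'B(K)}.
Context {I : countType} {H : I -> hilbert R} { pi : forall r, 'B(K) -> 'B(H r)}.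
Hypothesis hA : star_algebra A.
Hypothesis hpi : linfty_sum_decomposition A pi.

Notation incl := (summand_incl A pi).

Context {L L' : hilbert R} (X : 'B(L ⊗ K, L' ⊗ K)).
Hypothesis hX : forall a b, A (slice_l_vec a b X).

(** Tested on coefficients, this is the centrality of the block unit against the slices of [X],
    which lie in [A]. *)
Lemma central_commute r : (𝟙 ⊗ₒ incl r 𝟙) ∘ X = X ∘ (𝟙 ⊗ₒ incl r 𝟙).
Proof.
apply: op_ext_pure => a c; apply: dot_pure => b d.
rewrite !comp_opE dot_adj adj_tensor_op adj1 !tensor_opE (incl_adj hA hpi) adj1 /=.
rewrite -!dot_slice_l_vec -[slice_l_vec a b X (incl r 𝟙 c)]comp_opE.
by rewrite (incl_unit_central hA hpi) // comp_opE [RHS]dot_adj (incl_adj hA hpi) adj1.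
Qed.

Section AdaptedFamily.
Variables (r : I) (n : option nat) (e : nat -> H r) (f : nat -> K).
Hypotheses (he : orthonormal_basis n e) (hf : @adapted_family _ _ A _ _ pi r n e f).

(** The minimal projection [e_kk] sends [A f_i] into the line of [f_k], so the second leg collapses
    to [f_k]. *)
Lemma diag_unit_slice i k a : below n i -> below n k ->
  (𝟙 ⊗ₒ incl r (rank_one (e k) (e k))) (X (a ⊗ᵥ f i)) =
  slice_r_vec (f i) (f k) X a ⊗ᵥ f k.
Proof.
move=> ni nk; have [_ _ _ F3 F4] := hf nk ni.
apply: dot_pure => b d; rewrite dot_adj adj_tensor_op adj1 tensor_opE /=.
rewrite -dot_slice_l_vec -dot_adj F3 // dot_tens dotZl -F4 //.
by rewrite dot_slice_l_vec dot_slice_r_vec.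
Qed.

Lemma sum_slice_tens m i a : below n i ->
  \sum_(k < m | below n k) slice_r_vec (f i) (f k) X a ⊗ᵥ f k =
  (𝟙 ⊗ₒ incl r (basis_projection n e m)) (X (a ⊗ᵥ f i)).
Proof.
move=> ni; rewrite (incl_sum hA hpi) tensor_op_sumr op_sumE.
by apply: eq_bigr => k nk; rewrite diag_unit_slice.
Qed.

Lemma unit_slice i a : below n i ->
  (𝟙 ⊗ₒ incl r 𝟙) (X (a ⊗ᵥ f i)) = X (a ⊗ᵥ f i).
Proof.
move=> ni; have [_ F1 _ _ _] := hf ni ni.
by rewrite -comp_opE central_commute comp_opE tensor_opE F1.
Qed.

Lemma slice_orthogonality (Y : 'B(L' ⊗ K, L ⊗ K)) i j : Y ∘ X = 𝟙 ->
  below n i -> below n j ->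
  strong_cvg \oo
    (fun m => \sum_(k < m | below n k)
       slice_r_vec (f k) (f i) Y ∘ slice_r_vec (f j) (f k) X)
    ((i == j)%:R *: 𝟙).
Proof.
move=> YX ni nj a; have [F0 _ _ _ _] := hf nj ni.
have s m : (\sum_(k < m | below n k)
       slice_r_vec (f k) (f i) Y ∘ slice_r_vec (f j) (f k) X) a =
    adj (ketr (f i)) (Y ((𝟙 ⊗ₒ incl r (basis_projection n e m)) (X (a ⊗ᵥ f j)))).
  rewrite -sum_slice_tens // op_sumE !op_sum; apply: eq_bigr => k nk.
  by rewrite comp_opE [slice_r_vec (f k) _ _]slice_r_vecE !comp_opE ketrE.
under eq_cvg do rewrite s.
have -> : ((i == j)%:R *: 𝟙 : 'B(L)) a =
    adj (ketr (f i)) (Y ((𝟙 ⊗ₒ incl r 𝟙) (X (a ⊗ᵥ f j)))).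
  rewrite unit_slice // -[Y _]comp_opE YX adj_ketrE F0 opZE.
  by rewrite eq_sym.
apply: op_cvg; apply: op_cvg.
apply: tensor_strong_cvgr => [m|]; last exact: basis_projection_cvg.
by apply: (incl_projection hA hpi); exact: basis_projectionP.
Qed.

(** For each [x] in [A], [e_ii x e_jj] is the coefficient of [x] times [e_ij]; apply this to the
    slices of [X]. *)
Lemma slice_tens_unit i j : below n i -> below n j ->
  slice_r_vec (f j) (f i) X ⊗ₒ incl r (rank_one (e i) (e j)) =
  (𝟙 ⊗ₒ incl r (rank_one (e i) (e i))) ∘ X ∘ (𝟙 ⊗ₒ incl r (rank_one (e j) (e j))).
Proof.
move=> ni nj; have [_ _ _ _ F4] := hf ni nj.
apply: op_ext_pure => a c; apply: dot_pure => b d.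
rewrite !comp_opE !tensor_opE dot_tens dot_slice_r_vec -dot_slice_l_vec F4 //.
rewrite [RHS]dot_adj adj_tensor_op adj1 tensor_opE -dot_slice_l_vec -dot_adj.
rewrite -!comp_opE -compA (mul_incl hA hpi) // (incl_comp hA hpi) comp_rank_one.
by rewrite comp_rank_one rank_oneE rank_oneZ (inclZ hA hpi) opZE dotZl.
Qed.

End AdaptedFamily.

End SlicesInAlgebra.

Section FlipAndStates.
Context {R : realType} {tp : tensor_products R}.
Implicit Types L : hilbert R.

Lemma slice_vector_functional L L' (v : L') (X : 'B(L ⊗ L')) :
  slice_r (vector_functional v) X = slice_r_vec v v X.
Proof. exact: slice_r_vector. Qed.

Lemma adj_flip L L' : adj (flip L L') = flip L' L.
Proof.
apply: op_ext_pure => a b; apply: dot_pure => c d.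
by rewrite dot_adjl !flipE !dot_tens mulrC.
Qed.

End FlipAndStates.

Section Coefficients.
Context {R : realType} {tp : tensor_products R} {L2M L2N : hilbert R}.
Context {M : set 'B(L2M)} {DM : 'B(L2M) -> 'B(L2M ⊗ L2M)} {xi : L2M}.
Context {N : set 'B(L2M, L2N)} {DN : 'B(L2M, L2N) -> 'B(L2M ⊗ L2M, L2N ⊗ L2N)}.
Hypothesis hM : compact_woronowicz M DM xi.
Hypothesis hN : right_galois_coobject M DM N DN.
Context {V : 'B(L2N ⊗ L2M, L2N ⊗ L2N)} {W : 'B(L2N ⊗ L2N, L2M ⊗ L2N)}.
Hypothesis hV : is_Vtilde xi N DN V.
Hypothesis hW : is_Wtilde xi N DN W.
Context {I : countType} {H : I -> hilbert R} { pi : forall r, 'B(L2N) -> 'B(H r)}.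
Hypothesis hpi : linfty_sum_decomposition (dual_algebra V) pi.
Context {n : I -> option nat} {e : forall r, nat -> H r}.
Hypothesis he : forall r, orthonormal_basis (n r) (e r).

Notation A := (dual_algebra V).
Notation incl := (summand_incl A pi).
Notation w := (W_coef W pi e).
Notation u := (matrix_unit A pi e).
Notation P r m := (incl r (basis_projection (n r) (e r) m)).

Let hA : star_algebra A := dual_star_algebra (vt_unitary hV).
Let hWA := dual_slice hM hN hV hW.
Let hWA' := dual_slice_adj hM hN hV hW.

Lemma below0 (m : option nat) i : below m i -> below m 0.
Proof. by case: m => //= m; exact: leq_ltn_trans. Qed.

Lemma P_projection r m : projection (P r m).
Proof. by apply: (incl_projection hA hpi); exact: basis_projectionP. Qed.

Lemma P_cvg (L : hilbert R) r :
  strong_cvg \oo (fun m => (𝟙 : 'B(L)) ⊗ₒ P r m) (𝟙 ⊗ₒ incl r 𝟙).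
Proof.
apply: tensor_strong_cvgr => [m|]; first exact: P_projection.
by apply: (basis_projection_cvg hA hpi).
Qed.

Section Component.
Variables (r : I) (f : nat -> L2N).
Hypothesis hf : @adapted_family _ _ A _ _ pi r (n r) (e r) f.

Lemma W_coefE i j : below (n r) i -> below (n r) j ->
  w r i j = slice_r_vec (f j) (f i) W.
Proof.
move=> ni nj; apply: slice_r_vector => a b.
have [_ _ _ _ F4] := hf ni nj; rewrite F4 //; exact: hWA.
Qed.

Lemma adj_W_coefE i j : below (n r) i -> below (n r) j ->
  adj (w r i j) = slice_r_vec (f i) (f j) (adj W).
Proof. by move=> ni nj; rewrite W_coefE // adj_slice_r_vec. Qed.

Lemma adj_W_coef_N i j : below (n r) i -> below (n r) j -> N (adj (w r i j)).
Proof. by move=> ni nj; rewrite adj_W_coefE //; exact: (slice_adj_Wtilde_N hM hN hW). Qed.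

Lemma W_coef_tens i j : below (n r) i -> below (n r) j ->
  w r i j ⊗ₒ u r i j = (𝟙 ⊗ₒ u r i i) ∘ W ∘ (𝟙 ⊗ₒ u r j j).
Proof. by move=> ni nj; rewrite W_coefE //; exact: (slice_tens_unit hA hpi hWA hf). Qed.

Lemma W_coef_row i j : below (n r) i -> below (n r) j ->
  strong_cvg \oo
    (fun m => \sum_(k < m | below (n r) k) w r i k ∘ adj (w r j k))
    ((i == j)%:R *: 𝟙).
Proof.
move=> ni nj.
have s m : \sum_(k < m | below (n r) k) w r i k ∘ adj (w r j k) =
    \sum_(k < m | below (n r) k)
      slice_r_vec (f k) (f i) W ∘ slice_r_vec (f j) (f k) (adj W).
  by apply: eq_bigr => k nk; rewrite adj_W_coefE // W_coefE.
rewrite (funext s).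
exact: (slice_orthogonality hA hpi hWA' (he r) hf (wt_unitary hW).2).
Qed.

Lemma W_coef_column i j : below (n r) i -> below (n r) j ->
  strong_cvg \oo
    (fun m => \sum_(k < m | below (n r) k) adj (w r k i) ∘ w r k j)
    ((i == j)%:R *: 𝟙).
Proof.
move=> ni nj.
have s m : \sum_(k < m | below (n r) k) adj (w r k i) ∘ w r k j =
    \sum_(k < m | below (n r) k)
      slice_r_vec (f k) (f i) (adj W) ∘ slice_r_vec (f j) (f k) W.
  by apply: eq_bigr => k nk; rewrite adj_W_coefE // W_coefE.
rewrite (funext s).
exact: (slice_orthogonality hA hpi hWA (he r) hf (wt_unitary hW).1).
Qed.

(* With [A_i a = W^*(a ⊗ f_i)] and [D_j (c ⊗ b) = (ι ⊗ f_j^* )W^*(b ⊗ c)], the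
   partial sums are [(ι ⊗ D_j)((ι ⊗ P_m)A_i ⊗ ι)], uniformly bounded. *)
Lemma DN_adj_W_coef i j : below (n r) i -> below (n r) j ->
  strong_star_cvg \oo
    (fun m => \sum_(k < m | below (n r) k) adj (w r i k) ⊗ₒ adj (w r k j))
    (DN (adj (w r i j))).
Proof.
move=> ni nj.
have [a_i a_iE] : exists x : 'B(L2M, L2N ⊗ L2N), forall a, x a = adj W (a ⊗ᵥ f i).
  by exists (adj W ∘ ketr (f i)) => a; rewrite comp_opE ketrE.
have [d_j d_jE] : exists x : 'B(L2N ⊗ L2M, L2N),
    forall c b, x (c ⊗ᵥ b) = adj (ketr (f j)) (adj W (b ⊗ᵥ c)).
  exists (adj (ketr (f j)) ∘ adj W ∘ flip L2N L2M) => c b.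
  by rewrite !comp_opE flipE.
have [x xE] : exists x : 'B((L2N ⊗ L2N) ⊗ L2M, L2N ⊗ L2N),
    x = (𝟙 ⊗ₒ d_j) ∘ assoc L2N L2N L2M by eexists.
have [y yE] : exists y : 'B(L2M ⊗ L2M, (L2N ⊗ L2N) ⊗ L2M), y = a_i ⊗ₒ 𝟙 by eexists.
have [Q QE] : exists Q : nat -> 'B((L2N ⊗ L2N) ⊗ L2M),
    Q = fun m => (𝟙 ⊗ₒ P r m) ⊗ₒ 𝟙 by eexists.
have s m : \sum_(k < m | below (n r) k) adj (w r i k) ⊗ₒ adj (w r k j) = x ∘ Q m ∘ y.
  apply: op_ext_pure => a b; rewrite op_sumE xE yE QE !comp_opE !tensor_opE a_iE.
  rewrite -(sum_slice_tens hA hpi hWA' hf) // tens_suml !op_sum.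
  apply: eq_bigr => k nk; rewrite assocE !tensor_opE d_jE !adj_W_coefE //.
  by rewrite !slice_r_vecE !comp_opE !ketrE.
(* The limit has the block unit between [x] and [y]; it acts trivially on [W^*(a ⊗ f_i)], which
   leaves the formula for [DN] on slices. *)
have lim : DN (adj (w r i j)) = x ∘ ((𝟙 ⊗ₒ incl r 𝟙) ⊗ₒ 𝟙) ∘ y.
  apply: op_ext_pure => a b; apply: dot_pure => a' b'.
  rewrite adj_W_coefE // (DN_slice_adj_Wtilde hM hN hW).
  rewrite xE yE !comp_opE !tensor_opE a_iE (unit_slice hA hpi hWA' hf) //.
  rewrite -[b' ⊗ᵥ f j]ketrE -[a' ⊗ᵥ ketr _ _]/(a' ⊗ᵥ _).
  have -> : a' ⊗ᵥ ketr (f j) b' = (𝟙 ⊗ₒ ketr (f j)) (a' ⊗ᵥ b') by rewrite tensor_opE.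
  rewrite -dot_adjl adj_tensor_op adj1; congr ('[_, _]).
  set Z := adj W (a ⊗ᵥ f i); rewrite -[Z ⊗ᵥ b]ketrE -!comp_opE.
  congr (bounded_op_fun _ Z); apply: op_ext_pure => p q.
  by rewrite !comp_opE ketrE assocE !tensor_opE d_jE comp_opE ketlE.
rewrite (funext s) lim; apply: strong_star_sandwich.
- move=> m; rewrite QE; apply: tensor_projection (projection1 _).
  by apply: tensor_projection (projection1 _) (P_projection r m).
- apply: tensor_projection (projection1 _).
  apply: tensor_projection (projection1 _) _.
  by apply: (incl_projection hA hpi); exact: projection1.
rewrite QE; apply: tensor_strong_cvgl => [m|]; last exact: P_cvg.
by apply: tensor_projection; [exact: projection1 | exact: P_projection].
Qed.

Lemma W_coef_xi i k : below (n r) i -> below (n r) k ->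
  incl r 𝟙 (adj (w r i k) xi) = adj (w r i k) xi.
Proof.
move=> ni nk; have [_ F1 _ _ _] := hf ni ni.
have [Ap _ _] := inclP hpi (𝟙 : 'B(H r)).
have pV : (incl r 𝟙 ⊗ₒ 𝟙) ∘ V = V ∘ (incl r 𝟙 ⊗ₒ 𝟙).
  have [_ V2] := vt_unitary hV.
  have pV : adj V ∘ (incl r 𝟙 ⊗ₒ 𝟙) ∘ V = incl r 𝟙 ⊗ₒ 𝟙 by exact: Ap.
  by rewrite -[in RHS]pV !compA V2 comp1l.
(* Here the block unit acts on the first leg, where [central_commute] says nothing; trading [W^*]
   for [V] at [xi] moves it onto [f i]. *)
have pW : (incl r 𝟙 ⊗ₒ 𝟙) (adj W (xi ⊗ᵥ f i)) = adj W (xi ⊗ᵥ f i).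
  rewrite -(Vtilde_xi hM hN hV hW) -comp_opE pV comp_opE tensor_opE F1.
  by [].
rewrite adj_W_coefE // slice_r_vecE !comp_opE ketrE -[in RHS]pW.
rewrite -!comp_opE; congr (bounded_op_fun _ (adj W (xi ⊗ᵥ f i))).
apply: op_ext_pure => p q; rewrite !comp_opE tensor_opE !adj_ketrE opZ.
by [].
Qed.

End Component.

(** Any admissible index provides [e_0], from which the adapted family is generated. *)
Lemma adapted_ex r i : below (n r) i ->
  exists f, @adapted_family _ _ A _ _ pi r (n r) (e r) f.
Proof. by move=> /below0; exact: (adapted_family_exists hA hpi). Qed.

Lemma component_sum r p q :
  \sum_(i < p | below (n r) i) \sum_(j < q | below (n r) j) w r i j ⊗ₒ u r i j =
  (𝟙 ⊗ₒ P r p) ∘ W ∘ (𝟙 ⊗ₒ P r q).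
Proof.
rewrite !(incl_sum hA hpi) !tensor_op_sumr !comp_suml; apply: eq_bigr => i ni.
rewrite comp_sumr; apply: eq_bigr => j nj.
by have [f hf] := adapted_ex ni; exact: (W_coef_tens hf).
Qed.

Lemma component_cvg r :
  strong_star_cvg (filter_prod \oo \oo)
    (fun m : nat * nat => \sum_(i < m.1 | below (n r) i)
       \sum_(j < m.2 | below (n r) j) w r i j ⊗ₒ u r i j)
    ((𝟙 ⊗ₒ incl r 𝟙) ∘ W ∘ (𝟙 ⊗ₒ incl r 𝟙)).
Proof.
have c1 (L : hilbert R) : strong_cvg (filter_prod \oo \oo)
    (fun m : nat * nat => (𝟙 : 'B(L)) ⊗ₒ P r m.1) (𝟙 ⊗ₒ incl r 𝟙).
  by move=> v; exact: (cvg_comp _ _ cvg_fst (@P_cvg L r v)).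
have c2 (L : hilbert R) : strong_cvg (filter_prod \oo \oo)
    (fun m : nat * nat => (𝟙 : 'B(L)) ⊗ₒ P r m.2) (𝟙 ⊗ₒ incl r 𝟙).
  by move=> v; exact: (cvg_comp _ _ cvg_snd (@P_cvg L r v)).
have proj (L : hilbert R) m : projection ((𝟙 : 'B(L)) ⊗ₒ P r m).
  exact: tensor_projection (projection1 _) (P_projection r m).
have proj1 (L : hilbert R) : projection ((𝟙 : 'B(L)) ⊗ₒ incl r 𝟙).
  apply: tensor_projection (projection1 _) _.
  by apply: (incl_projection hA hpi); exact: projection1.
rewrite (funext (fun m : nat * nat => component_sum r m.1 m.2)); split.
  by apply: strong_cvg_mul.
(* Taking adjoints exchanges the row and column truncations, so the same product argument applies to
   [W^*]. *)
have -> : (fun m : nat * nat => adj ((𝟙 ⊗ₒ P r m.1) ∘ W ∘ (𝟙 ⊗ₒ P r m.2))) =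
    (fun m => (𝟙 ⊗ₒ P r m.2) ∘ adj W ∘ (𝟙 ⊗ₒ P r m.1)).
  by apply/funext => m; rewrite !adj_comp (proj _ _).1 (proj _ _).1 compA.
rewrite !adj_comp (proj1 _).1 (proj1 _).1 compA.
by apply: strong_cvg_mul.
Qed.

(** Centrality gives [p_r W p_r = W p_r] on the second leg, so a finite sum of blocks is [W] times a
    single projection increasing to 1. *)
Lemma components_cvg :
  strong_star_cvg totally
    (partial_sum (fun r => (𝟙 ⊗ₒ incl r 𝟙) ∘ W ∘ (𝟙 ⊗ₒ incl r 𝟙))) W.
Proof.
pose p := partial_sum (fun r => incl r 𝟙).
have pP J : projection (p J) := summands_projection hA hpi J.
have s J : partial_sum (fun r => (𝟙 ⊗ₒ incl r 𝟙) ∘ W ∘ (𝟙 ⊗ₒ incl r 𝟙)) J =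
    W ∘ (𝟙 ⊗ₒ p J) ∘ 𝟙.
  rewrite comp1 /p /partial_sum tensor_op_sumr comp_sumr; apply: eq_bigr => r _.
  rewrite (central_commute hA hpi hWA) -compA -tensor_op_comp comp1.
  by rewrite (incl_comp hA hpi) comp1.
rewrite (funext s) -[X in strong_star_cvg _ _ X]comp1.
rewrite -[X in strong_star_cvg _ _ (X ∘ _)]comp1 -tensor_op1.
have FF := @totally_filter I.
apply: strong_star_sandwich => [J||].
- exact: tensor_projection (projection1 _) (pP J).
- exact: tensor_projection (projection1 _) (projection1 _).
apply: tensor_strong_cvgr => //; exact: (summands_cvg hA hpi).
Qed.

Lemma W_coef_ortho r s i j k l : r != s ->
  below (n r) i -> below (n r) j -> below (n s) k -> below (n s) l ->
  '[adj (w s k l) xi, adj (w r i j) xi] = 0.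
Proof.
move=> rs ni nj nk nl.
have [f hf] := adapted_ex ni; have [g hg] := adapted_ex nk.
rewrite -(W_coef_xi hf ni nj) -(W_coef_xi hg nk nl) -dot_adjl.
rewrite (incl_adj hA hpi) adj1 -comp_opE (incl_ortho hA hpi); last exact/eqP.
by rewrite op0E dot0l.
Qed.

(** Tensor both vectors with [f_l = e_lj f_j], so that each becomes [1 ⊗ e_ll] or [1 ⊗ e_lj] applied
    to [W^*(xi ⊗ f_k)] or [W^*(xi ⊗ f_i)]. The matrix units combine to [e_jl] between these vectors,
    which is a coefficient of [Ad_R(e_jl)] sliced at [xi]; invariance replaces that slice by
    [phi(e_jl)] times the block unit. *)
Lemma W_coef_state r (phi : 'B(H r) -> R[i]) i j k l :
  is_invariant_state xi W A pi phi ->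
  below (n r) i -> below (n r) j -> below (n r) k -> below (n r) l ->
  '[adj (w r k l) xi, adj (w r i j) xi] =
    (i == k)%:R * phi (rank_one (e r j) (e r l)).
Proof.
move=> hphi ni nj nk nl; have [f hf] := adapted_ex ni.
have wf a b : below (n r) a -> below (n r) b ->
    adj (w r a b) xi ⊗ᵥ f b = (𝟙 ⊗ₒ u r b b) (adj W (xi ⊗ᵥ f a)).
  move=> na nb; rewrite (adj_W_coefE hf) //.
  by rewrite (diag_unit_slice hWA' hf).
have uE a b : below (n r) a -> below (n r) b ->
    adj (𝟙 ⊗ₒ u r a b : 'B(L2N ⊗ L2N)) = 𝟙 ⊗ₒ u r b a.
  by move=> na nb; rewrite adj_tensor_op adj1 (incl_adj hA hpi) adj_rank_one.
have uu a b c : below (n r) a -> below (n r) b -> below (n r) c ->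
    u r a b ∘ u r b c = u r a c.
  move=> na nb nc; rewrite /matrix_unit (incl_comp hA hpi) comp_rank_one rank_oneE.
  by rewrite (he r).1 // eqxx scale1r.
have [F0 _ _ _ _] := hf _ _ nl nl; have [_ _ F2 _ _] := hf _ _ nl nj.
have -> : '[adj (w r k l) xi, adj (w r i j) xi] =
    '[adj (w r k l) xi ⊗ᵥ f l, adj (w r i j) xi ⊗ᵥ f l].
  by rewrite dot_tens F0 eqxx mulr1.
have {2}-> : f l = u r l j (f j) by rewrite /matrix_unit F2 // eqxx scale1r.
have -> : adj (w r i j) xi ⊗ᵥ u r l j (f j) =
    (𝟙 ⊗ₒ u r l j) (adj W (xi ⊗ᵥ f i)).
  have -> : adj (w r i j) xi ⊗ᵥ u r l j (f j) =
      (𝟙 ⊗ₒ u r l j) (adj (w r i j) xi ⊗ᵥ f j) by rewrite tensor_opE.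
  by rewrite wf // -comp_opE -tensor_op_comp comp1 uu.
rewrite wf // -dot_adjl uE // -comp_opE -tensor_op_comp comp1 uu //.
have := Defs.inv_eq hphi (rank_one (e r j) (e r l)).
rewrite slice_vector_functional => /(congr1 (fun x : 'B(L2N) => '[x (f k), f i])).
rewrite opZE dotZl dot_slice_r_vec /Ad_R !comp_opE.
have [F0' _ _ _ _] := hf _ _ nk ni; have [_ F1 _ _ _] := hf _ _ nk nk; rewrite F1 F0'.
rewrite dot_adj adj_flip !flipE dot_adj => ->.
by rewrite mulrC eq_sym.
Qed.

End Coefficients.

Lemma trace_rank_one (R : realType) (H : hilbert R) (n : option nat) (e : nat -> H)
    (T : 'B(H)) (t : nat -> R[i]) (c : R[i]) j l :
  orthonormal_basis n e -> (forall i, below n i -> T (e i) = t i *: e i) ->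
  below n j -> below n l -> has_trace (T ∘ rank_one (e j) (e l)) c ->
  c = (j == l)%:R * t j.
Proof.
move=> he hT nj nl /(_ n e he) hc; apply: (norm_cvg_unique hc).
(* Only the index [l] contributes to the trace, so the partial sums are constant once [m > l]. *)
apply: (@cvg_near_cst _ R[i]^o); exists l.+1 => // m /= lm.
rewrite (bigD1 (Ordinal lm)) //= big1 ?addr0.
  rewrite rank_oneE he.1 // eqxx scale1r hT // dotZl he.1 //.
  by rewrite mulrC.
move=> k /andP[nk kl]; rewrite rank_oneE he.1 //.
by move: kl; rewrite -val_eqE /= => /negbTE ->; rewrite scale0r op0 dot0l.
Qed.

Local Open Scope complex_scope.

Theorem theorem1p15 (R : realType) (tp : tensor_products R)
    (L2M : hilbert R) (M : set 'B(L2M)) (DM : 'B(L2M) -> 'B(L2M ⊗ L2M))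
    (xi : L2M) (hM : compact_woronowicz M DM xi)
    (L2N : hilbert R) (N : set 'B(L2M, L2N))
    (DN : 'B(L2M, L2N) -> 'B(L2M ⊗ L2M, L2N ⊗ L2N))
    (hN : right_galois_coobject M DM N DN)
    (V : 'B(L2N ⊗ L2M, L2N ⊗ L2N)) (hV : is_Vtilde xi N DN V)
    (W : 'B(L2N ⊗ L2N, L2M ⊗ L2N)) (hW : is_Wtilde xi N DN W)
    (I : countType) (H : I -> hilbert R) (pi : forall r, 'B(L2N) -> 'B(H r))
    (hpi : linfty_sum_decomposition (dual_algebra V) pi)
    (phi : forall r, 'B(H r) -> R[i])
    (hphi : forall r, is_invariant_state xi W (dual_algebra V) pi (phi r))
    (T : forall r, 'B(H r)) (hT : forall r, positive_trace_class (T r))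
    (hphiT : forall r y, has_trace (T r ∘ y) (phi r y))
    (n : I -> option nat) (e : forall r, nat -> H r)
    (he : forall r, orthonormal_basis (n r) (e r))
    (t : I -> nat -> R)
    (hTe : forall r i, below (n r) i -> T r (e r i) = (t r i)%:C *: e r i)
    (ht : forall r i j, (i <= j)%N -> below (n r) j -> t r j <= t r i) :
  let w := W_coef W pi e in
  let u := matrix_unit (dual_algebra V) pi e in
  (forall r i j, below (n r) i -> below (n r) j ->
     opposite_space N (w r i j)) /\
  [/\
    exists S : I -> 'B(L2N ⊗ L2N, L2M ⊗ L2N),
      (forall r, strong_star_cvg (filter_prod \oo \oo)
         (fun m : nat * nat => \sum_(i < m.1 | below (n r) i)
            \sum_(j < m.2 | below (n r) j) (w r i j ⊗ₒ u r i j)) (S r)) /\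
      strong_star_cvg totally (partial_sum S) W,
    forall r i j, below (n r) i -> below (n r) j ->
      strong_cvg \oo
        (fun m : nat => \sum_(k < m | below (n r) k) w r i k ∘ adj (w r j k))
        ((i == j)%:R *: 𝟙) /\
      strong_cvg \oo
        (fun m : nat => \sum_(k < m | below (n r) k) adj (w r k i) ∘ w r k j)
        ((i == j)%:R *: 𝟙),
    forall r i j, below (n r) i -> below (n r) j ->
      strong_star_cvg \oo
        (fun m : nat => \sum_(k < m | below (n r) k)
           adj (w r i k) ⊗ₒ adj (w r k j))
        (DN (adj (w r i j))) &
    forall r s i j k l,
      below (n r) i -> below (n r) j -> below (n s) k -> below (n s) l ->
      vector_functional xi (w r i j ∘ adj (w s k l)) =
        [&& r == s, i == k & j == l]%:R * (t r j)%:C ].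
Proof.
move=> w u; split=> [r i j ni nj|].
  have [f hf] := adapted_ex hV hpi he ni.
  exists (adj (w r i j)); last exact: adjK.
  exact: (adj_W_coef_N hM hN hV hW hf).
split.
- exists (fun r => (𝟙 ⊗ₒ summand_incl (dual_algebra V) pi r 𝟙) ∘ W ∘
    (𝟙 ⊗ₒ summand_incl (dual_algebra V) pi r 𝟙)); split.
    by move=> r; exact: (component_cvg hM hN hV hW hpi he).
  exact: (components_cvg hM hN hV hW hpi).
- move=> r i j ni nj; have [f hf] := adapted_ex hV hpi he ni; split.
    exact: (W_coef_row hM hN hV hW hpi he hf).
  exact: (W_coef_column hM hN hV hW hpi he hf).
- move=> r i j ni nj; have [f hf] := adapted_ex hV hpi he ni.
  exact: (DN_adj_W_coef hM hN hV hW hpi he hf).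
move=> r s i j k l ni nj nk nl.
rewrite /vector_functional comp_opE dot_adj.
have [rs|rs] := eqVneq r s; last first.
  by rewrite (W_coef_ortho hM hN hV hW hpi he) // mul0r.
subst s; rewrite (W_coef_state hM hN hV hW hpi he (hphi r)) //.
(* The state at [e_jl] is [Tr(T_r e_jl)], the diagonal entry [t r j] when [j = l] and 0
   otherwise. *)
rewrite (trace_rank_one (he r) (hTe r) nj nl (hphiT r _)) /=.
by rewrite mulrA -natrM mulnb.
Qed.
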